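(* Let $M$ be the matroid associated to the Pascal configuration. Then $$I_M=\sqrt{I_{\mathcal C(M)}+G_M+I_M^{\mathrm{lift}}}.$$
   Context: The Pascal configuration is the simple rank-three matroid $M$ on $[9]=\{1,\dots,9\}$ whose circuits of size three are exactly its lines $\{1,6,8\},\{1,5,7\},\{2,4,7\},\{2,6,9\},\{3,4,8\},\{3,5,9\},\{7,8,9\}$. For a point $x$, $\mathcal L_x$ is the set of lines containing $x$. $\Gamma_M$ is the set of $\gamma=(\gamma_1,\dots,\gamma_9)\in(\mathbb C^3)^9$ such that a subset of $[9]$ is dependent in $M$ if and only if the corresponding vectors $\gamma_i$ are linearly dependent. $V_M$ is the Zariski closure of $\Gamma_M$ and $I_M=I(V_M)\subset\mathbb C[X]$, where $X$ is a $3\times 9$ matrix of indeterminates whose $i$-th column is associated with the point $i$. For points $i,j,k$ and $q\in\mathbb C^3$, the bracket $[i,j,k]$ is the determinant of columns $i,j,k$ of $X$, and $[i,j,q]$ is the determinant of the matrix with columns $i$, $j$ of $X$ and $q$. Circuit ideal: $I_{\mathcal C(M)}$ is generated by the brackets $[i,j,k]$ for all circuits $\{i,j,k\}$ of size three of $M$. Grassmann-Cayley ideal $G_M$: let $X_0$ be the set of all brackets $[i,j,k]$ with $\{i,j,k\}$ a circuit of size three of $M$ (a generating set of $I_{\mathcal C(M)}$). Given a polynomial $P$, a point $x$, lines $l_1\ne l_2$ in $\mathcal L_x$, and points $p_1,p_2\in l_1$, $p_3,p_4\in l_2$, let $P'$ be obtained from $P$ by replacing column $x$ by the vector $[p_1,p_2,p_3]\,p_4-[p_1,p_2,p_4]\,p_3$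 (here $p_3,p_4$ outside brackets denote columns of $X$). For $j\ge1$, $X_j$ is the union of $X_{j-1}$ and all polynomials $P'$ so obtained from $P\in X_{j-1}$. The ascending chain $\langle X_0\rangle\subset\langle X_1\rangle\subset\cdots$ stabilizes, and $G_M$ is its stable value. Lifting ideal $I_M^{\mathrm{lift}}$: for a submatroid (restriction) $N$ of $M$ and $q\in\mathbb C^3$, the liftability matrix $\mathcal M_q(N)$ has columns indexed by the points of $N$ and rows indexed by the circuits of size three of $N$; the row of $\{c_1<c_2<c_3\}$ has entries $[c_2,c_3,q]$, $-[c_1,c_3,q]$, $[c_1,c_2,q]$ in columns $c_1,c_2,c_3$ respectively and zeros elsewhere. $I_M^{\mathrm{lift}}$ is the ideal generated by all $(|N|-2)$-minors of the matrices $\mathcal M_q(N)$, where $N$ ranges over all full-rank (rank three) submatroids of $M$, $|N|$ is the number of points of $N$, and $q$ ranges over $\mathbb C^3$. *)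

(* Defs.v *)
From HB Require Import structures.
From mathcomp Require Import all_boot all_order all_algebra.
From mathcomp Require Import mpoly.
From mathcomp Require Import complex.
From mathcomp Require Import reals.

Set Implicit Arguments.
Unset Strict Implicit.
Unset Printing Implicit Defensive.

Import GRing.Theory.

Local Open Scope ring_scope.

(* Matroids on a subset of a finite type; keeping the ground set explicit lets
   a restriction of M live on the same carrier type as M. *)
Record matroid (E : finType) := Matroid {
  ground : {set E};
  indep : {set E} -> bool;
  indep_ground : forall A, indep A -> A \subset ground;
  indep0 : indep set0;
  indep_sub : forall A B : {set E}, A \subset B -> indep B -> indep A;
  indep_aug : forall A B : {set E}, indep A -> indep B -> (#|A| < #|B|)%N ->
    exists2 x, x \in B :\: A & indep (x |: A)
}.

Section MatroidNotions.
Variables (E : finType) (M : matroid E).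

Definition dependent (A : {set E}) : bool :=
  (A \subset ground M) && ~~ indep M A.

Definition circuit (C : {set E}) : bool := minset dependent C.

Definition mrank : nat := (\max_(A : {set E} | indep M A) #|A|)%N.

Definition simple_matroid : Prop := forall C, circuit C -> (2 < #|C|)%N.

(* The lines of a rank-three matroid: maximal sets of at least three points
   all of whose three-element subsets are dependent. *)
Definition collinear (A : {set E}) : bool :=
  (2 < #|A|)%N && [forall B : {set E}, (B \subset A) && (#|B| == 3) ==> dependent B].

Definition line (l : {set E}) : bool := maxset collinear l.

Variable S : {set E}.

Let rindep (A : {set E}) := indep M A && (A \subset S).

Fact restrict_ground A : rindep A -> A \subset ground M :&: S.
Proof. by case/andP=> /indep_ground AM AS; rewrite subsetI AM. Qed.

Fact restrict0 : rindep set0.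
Proof. by rewrite /rindep indep0 sub0set. Qed.

Fact restrict_sub (A B : {set E}) : A \subset B -> rindep B -> rindep A.
Proof.
move=> AB /andP[iB BS]; apply/andP; split; last exact: subset_trans AB BS.
exact: indep_sub AB iB.
Qed.

Fact restrict_aug (A B : {set E}) : rindep A -> rindep B -> (#|A| < #|B|)%N ->
  exists2 x, x \in B :\: A & rindep (x |: A).
Proof.
move=> /andP[iA AS] /andP[iB BS] /(indep_aug iA iB)[x xBA ixA].
exists x => //; rewrite /rindep ixA subUset AS sub1set andbT /=.
by apply: (subsetP BS); case/setDP: xBA.
Qed.

Definition restrict : matroid E :=
  Matroid restrict_ground restrict0 restrict_sub restrict_aug.

End MatroidNotions.

Section Ideals.
Variable P : comNzRingType.
Implicit Types (F I J : P -> Prop) (p : P).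

Definition ideal_gen F p : Prop :=
  exists (k : nat) (a g : 'I_k -> P),
    (forall i, F (g i)) /\ p = \sum_(i < k) a i * g i.

Definition ideal_add I J p : Prop :=
  exists a b, [/\ I a, J b & p = a + b].

Definition radical I p : Prop := exists m : nat, I (p ^+ m).

End Ideals.

(* Determinant of the matrix with columns u, v, w. *)
Definition det3 (P : comNzRingType) (u v w : 'cV[P]_3) : P :=
  \det (\matrix_(i < 3, j < 3) tnth [tuple u; v; w] j i ord0).

Section MatroidIdeals.
Variables (K : fieldType) (n : nat).

(* Coordinate ring of (K^3)^n, whose points are represented by 3 x n matrices,
   the i-th column being the i-th vector. *)
Local Notation Pol := {mpoly K[3 * n]}.

Definition X : 'M[Pol]_(3, n) := \matrix_(i, j) 'X_(mxvec_index i j).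

Definition evalX (p : Pol) (g : 'M[K]_(3, n)) : K := p.@[mxvec g ord0].

Implicit Types (V W : 'M[K]_(3, n) -> Prop).

Definition zariski_closed V : Prop :=
  exists F : Pol -> Prop, forall g, V g <-> (forall f, F f -> evalX f g = 0).

Definition zariski_closure V : 'M[K]_(3, n) -> Prop := fun g =>
  forall W, zariski_closed W -> (forall h, V h -> W h) -> W g.

Definition vanishing_ideal V : Pol -> Prop := fun p =>
  forall g, V g -> evalX p g = 0.

Variable M : matroid 'I_n.

Definition Gamma (g : 'M[K]_(3, n)) : Prop :=
  forall A : {set 'I_n}, A \subset ground M ->
    (dependent M A <-> ~~ free [seq col i g | i <- enum A]).

Definition matroid_variety : 'M[K]_(3, n) -> Prop := zariski_closure Gamma.

Definition matroid_ideal : Pol -> Prop := vanishing_ideal matroid_variety.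

Definition bracket (i j k : 'I_n) : Pol := det3 (col i X) (col j X) (col k X).

(* The bracket [i, j, q]. *)
Definition bracketq (i j : 'I_n) (q : 'cV[K]_3) : Pol :=
  det3 (col i X) (col j X) (map_mx (@mpolyC (3 * n) K) q).

Definition circuit_brackets (p : Pol) : Prop :=
  exists i j k : 'I_n,
    [/\ #|[set i; j; k]| = 3, circuit M [set i; j; k] & p = bracket i j k].

Definition circuit_ideal : Pol -> Prop := ideal_gen circuit_brackets.

Definition subst_col (x : 'I_n) (v : 'cV[Pol]_3) (p : Pol) : Pol :=
  let Y := \matrix_(i < 3, j < n) (if j == x then v i ord0 else X i j) in
  p \mPo [tuple mxvec Y ord0 k | k < 3 * n].

Fixpoint GC_gens (s : nat) : Pol -> Prop :=
  if s is t.+1 then fun p =>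
    GC_gens t p \/
    exists (p0 : Pol) (x : 'I_n) (l1 l2 : {set 'I_n}) (p1 p2 p3 p4 : 'I_n),
      GC_gens t p0 /\
      [/\ line M l1, line M l2, x \in l1, x \in l2 & l1 != l2] /\
      [/\ p1 \in l1, p2 \in l1, p3 \in l2 & p4 \in l2] /\
      p = subst_col x (bracket p1 p2 p3 *: col p4 X
                       - bracket p1 p2 p4 *: col p3 X) p0
  else circuit_brackets.

(* Stable value of the ascending chain of ideals <X_s>: what eventually belongs
   to all its terms (see GC_idealE). *)
Definition GC_ideal (p : Pol) : Prop :=
  exists s, forall t, (s <= t)%N -> ideal_gen (GC_gens t) p.

Lemma GC_idealE s :
    (forall t, (s <= t)%N ->
       forall p, ideal_gen (GC_gens t) p <-> ideal_gen (GC_gens s) p) ->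
  forall p, GC_ideal p <-> ideal_gen (GC_gens s) p.
Proof.
move=> stab p; split=> [[t tP]|sP]; last by exists s => t /stab/(_ p)[_]; exact.
by apply/(stab (maxn s t)); [exact: leq_maxl | apply/tP/leq_maxr].
Qed.

(* Circuits {c1 < c2 < c3} of size three, as ordered triples. *)
Definition circuit_triples (N : matroid 'I_n) : {set 'I_n * 'I_n * 'I_n} :=
  [set c : 'I_n * 'I_n * 'I_n | [&& (c.1.1 < c.1.2)%N, (c.1.2 < c.2)%N
                                   & circuit N [set c.1.1; c.1.2; c.2]]].

Definition liftability_entry (q : 'cV[K]_3) (c : 'I_n * 'I_n * 'I_n)
    (x : 'I_n) : Pol :=
  let: (c1, c2, c3) := c in
  if x == c1 then bracketq c2 c3 q
  else if x == c2 then - bracketq c1 c3 q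
  else if x == c3 then bracketq c1 c2 q
  else 0.

Definition liftability_matrix (q : 'cV[K]_3) (N : matroid 'I_n) :
    'M[Pol]_(#|circuit_triples N|, #|ground N|) :=
  \matrix_(i, j) liftability_entry q (enum_val i) (enum_val j).

(* Injective, not necessarily increasing, choices of rows and columns: they
   give the same minors up to sign. *)
Definition lifting_minors (p : Pol) : Prop :=
  exists (S : {set 'I_n}) (q : 'cV[K]_3),
    let N := restrict M S in
    exists (f : 'I_(#|ground N| - 2) -> 'I_#|circuit_triples N|)
           (g : 'I_(#|ground N| - 2) -> 'I_#|ground N|),
      [/\ mrank N = mrank M, injective f, injective g
        & p = \det (mxsub f g (liftability_matrix q N))].

Definition lifting_ideal : Pol -> Prop := ideal_gen lifting_minors.

End MatroidIdeals.

Arguments matroid_ideal K {n} M p.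
Arguments circuit_ideal K {n} M p.
Arguments GC_ideal K {n} M p.
Arguments lifting_ideal K {n} M p.

(* The Pascal configuration; the point labelled k in {1, ..., 9} is the element
   of 'I_9 with value k - 1. *)
Definition pascal_labels : seq (seq nat) :=
  [:: [:: 1; 6; 8]; [:: 1; 5; 7]; [:: 2; 4; 7]; [:: 2; 6; 9];
      [:: 3; 4; 8]; [:: 3; 5; 9]; [:: 7; 8; 9]]%N.

Definition pascal_lines : seq {set 'I_9} :=
  [seq [set x : 'I_9 | x.+1 \in s] | s <- pascal_labels].

Definition pascal_indep (A : {set 'I_9}) : bool :=
  (#|A| <= 3)%N && (A \notin pascal_lines).

Lemma card_pascal_line l : l \in pascal_lines -> #|l| = 3.
Proof.
case/mapP=> s sP ->; rewrite cardsE -sum1_card.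
rewrite -(big_mkord (fun x : nat => x.+1 \in s) (fun=> 1%N)) sum1_count.
by apply/eqP; move: s sP; apply/allP; vm_compute.
Qed.

Lemma pascal_lines_inj l m a b : l \in pascal_lines -> m \in pascal_lines ->
  a != b -> a \in l -> b \in l -> a \in m -> b \in m -> l = m.
Proof.
case/mapP=> s sP -> /mapP[t tP ->] ab; rewrite !inE => as_ bs at_ bt.
have /allP/(_ s sP)/allP/(_ t tP) : all (fun s : seq nat => all (fun t : seq nat =>
  (s == t) || (size [seq x <- s | x \in t] <= 1)%N) pascal_labels) pascal_labels.
  by vm_compute.
case/orP=> [/eqP -> //|]; rewrite leqNgt => /negP[].
apply: (@uniq_leq_size _ [:: a.+1; b.+1]) => [|x].
  by rewrite /= inE andbT eqSS.
by rewrite mem_filter !inE => /orP[] /eqP ->; apply/andP.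
Qed.

Fact pascal_indep_ground A : pascal_indep A -> A \subset setT.
Proof. by rewrite subsetT. Qed.

Fact pascal_indep0 : pascal_indep set0.
Proof.
by rewrite /pascal_indep cards0; apply/negP => /card_pascal_line; rewrite cards0.
Qed.

Fact pascal_indep_sub (A B : {set 'I_9}) :
  A \subset B -> pascal_indep B -> pascal_indep A.
Proof.
move=> AB /andP[B3 BP]; rewrite /pascal_indep (leq_trans (subset_leq_card AB) B3).
apply: contra BP => AP; suff <- : A = B by [].
by apply/eqP; rewrite eqEcard AB (card_pascal_line AP).
Qed.

Fact pascal_indep_aug (A B : {set 'I_9}) :
  pascal_indep A -> pascal_indep B -> (#|A| < #|B|)%N ->
  exists2 x, x \in B :\: A & pascal_indep (x |: A).
Proof.
move=> iA /andP[B3 BP] AB.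
have cU x : x \in B :\: A -> #|x |: A| = #|A|.+1.
  by case/setDP=> _ xA; rewrite cardsU1 xA.
case: (pickP [pred x in B :\: A | x |: A \notin pascal_lines]) => [x|none].
  case/andP=> xBA xP; exists x; first exact: xBA.
  by rewrite /pascal_indep xP andbT cU //; exact: leq_trans AB B3.
have allP x : x \in B :\: A -> x |: A \in pascal_lines.
  by move=> xBA; move: (none x) => /=; rewrite xBA /= => /negbFE.
have [x xBA] : exists x, x \in B :\: A.
  apply/set0Pn; rewrite setD_eq0; apply: contraL AB => /subset_leq_card.
  by rewrite -leqNgt.
have A2 : #|A| = 2 by have := card_pascal_line (allP x xBA); rewrite cU // => -[].
have/cards2P[a [b [ab defA]]] : #|A| == 2 by rewrite A2.
exfalso; move/negP: BP; apply; suff -> : B = x |: A by exact: allP.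
apply/eqP; rewrite eqEcard cU // AB andbT; apply/subsetP => y yB.
have [yA|yA] := boolP (y \in A); first by rewrite setU1r.
have yBA : y \in B :\: A by rewrite inE yA.
have aA : a \in A by rewrite defA !inE eqxx.
have bA : b \in A by rewrite defA !inE eqxx orbT.
have <- : y |: A = x |: A.
  by apply: pascal_lines_inj (allP y yBA) (allP x xBA) ab _ _ _ _; apply: setU1r.
exact: setU11.
Qed.

Definition pascal : matroid 'I_9 :=
  Matroid pascal_indep_ground pascal_indep0 pascal_indep_sub pascal_indep_aug.

Lemma pascal_dependent3 (A : {set 'I_9}) :
  #|A| = 3 -> dependent pascal A = (A \in pascal_lines).
Proof. by move=> A3; rewrite /dependent subsetT /= /pascal_indep A3 negbK. Qed.

Lemma pascal_simple : simple_matroid pascal.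
Proof.
move=> C /minsetp /andP[_ /=]; rewrite negb_and -ltnNge negbK.
by case/orP=> [/ltnW //|/card_pascal_line ->].
Qed.

Lemma pascal_circuit3 (C : {set 'I_9}) :
  #|C| = 3 -> circuit pascal C = (C \in pascal_lines).
Proof.
move=> C3; rewrite -pascal_dependent3 //; apply/idP/idP => [/minsetp //|dC].
apply/minsetP; split=> // B dB BC; apply/eqP; rewrite eqEcard BC C3 /=.
case/andP: dB => _ /=; rewrite negb_and -ltnNge negbK.
by case/orP=> [/ltnW //|/card_pascal_line ->].
Qed.

Lemma pascal_rank : mrank pascal = 3.
Proof.
apply/eqP; rewrite eqn_leq; apply/andP; split.
  by apply/bigmax_leqP => A /andP[].
pose a : 'I_9 := inord 0; pose b : 'I_9 := inord 1; pose c : 'I_9 := inord 2.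
have ab : a != b by rewrite -val_eqE /= !inordK.
have ac : a != c by rewrite -val_eqE /= !inordK.
have bc : b != c by rewrite -val_eqE /= !inordK.
have A3 : #|[set a; b; c]| = 3.
  by rewrite setUC cardsU1 cards2 ab !inE ![c == _]eq_sym (negPf ac) (negPf bc).
rewrite -A3; apply: (@leq_bigmax_cond _ (indep pascal) (fun A : {set 'I_9} => #|A|)).
rewrite /= /pascal_indep A3 /=; apply/mapP => -[s sP E].
have: a \in [set x : 'I_9 | x.+1 \in s] by rewrite -E !inE eqxx.
have: b \in [set x : 'I_9 | x.+1 \in s] by rewrite -E !inE eqxx orbT.
rewrite !inE !inordK // => s2 s1.
have /allP/(_ s sP) : all (fun t : seq nat => ~~ ((1 \in t) && (2 \in t)))%N
    pascal_labels by vm_compute.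
by rewrite s1 s2.
Qed.

Lemma pascal_line (l : {set 'I_9}) : line pascal l = (l \in pascal_lines).
Proof.
have three (A : {set 'I_9}) : (2 < #|A|)%N -> collinear pascal A ->
    A \in pascal_lines.
  move=> A2 /andP[_ /forallP Adep].
  have [B BA B3] : exists2 B : {set 'I_9}, B \subset A & #|B| = 3.
    have /card_gt0P[B] : (0 < #|[set B : {set 'I_9} | B \subset A & #|B| == 3]|)%N.
      by rewrite cards_draws bin_gt0.
    by rewrite inE => /andP[BA /eqP B3]; exists B.
  have BP : B \in pascal_lines.
    by rewrite -pascal_dependent3 //; have := Adep B; rewrite BA B3 eqxx.
  suff -> : A = B by [].
  apply/esym/eqP; rewrite eqEsubset BA; apply/subsetP => x xA.
  apply: contraT => xB.
  have [a aB] : exists a, a \in B by apply/card_gt0P; rewrite B3.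
  have BD : #|B :\ a| = 2 by move: B3; rewrite (cardsD1 a) aB => -[].
  have xBD : x \notin B :\ a by rewrite inE (negPf xB) andbF.
  have/cards2P[b [c [bc defB]]] : #|B :\ a| == 2 by rewrite BD.
  have C3 : #|x |: B :\ a| = 3 by rewrite cardsU1 xBD BD.
  have CP : x |: B :\ a \in pascal_lines.
    rewrite -pascal_dependent3 //; have := Adep (x |: B :\ a); rewrite C3 eqxx andbT.
    move/implyP; apply; rewrite subUset sub1set xA.
    exact: subset_trans (subsetDl _ _) BA.
  have bD : b \in B :\ a by rewrite defB !inE eqxx.
  have cD : c \in B :\ a by rewrite defB !inE eqxx orbT.
  have E : x |: B :\ a = B.
    apply: (pascal_lines_inj CP BP bc); rewrite ?(setU1r _ bD) ?(setU1r _ cD) //.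
      by case/setD1P: bD.
    by case/setD1P: cD.
  by move: xB; rewrite -E setU11.
apply/idP/idP => [/maxsetp cl|lP]; first by apply: three => //; case/andP: cl.
have l3 := card_pascal_line lP.
apply/maxsetP; split=> [|B cB lB].
  rewrite /collinear l3 /=; apply/forallP => B; apply/implyP => /andP[Bl /eqP B3].
  rewrite pascal_dependent3 //; suff -> : B = l by [].
  by apply/eqP; rewrite eqEcard Bl B3 l3.
have BP : B \in pascal_lines by apply: three => //; case/andP: cB.
by apply/esym/eqP; rewrite eqEcard lB l3 (card_pascal_line BP).
Qed.

(* Main.v *)
(** By the Nullstellensatz it suffices that the common zeros of the three ideals
    are exactly the points of V_M.

    Dually, the lines of M other than {7,8,9} are the corners p_0, ..., p_5 of a
    hexagon, the points 1,5,3,4,2,6 its sides s_i (joining p_i to p_{i+1}), and the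
    points 8,7,9 its main diagonals D_0, D_1, D_2, which concur at the point dual
    to {7,8,9}.  Once the D_i are nonzero and the p_i are not all equal, such a
    hexagon can be drawn edge after edge along a polynomial curve starting at a
    realization of M, so it lies in V_M.  V_M is moreover stable under every linear
    map and every rescaling of columns, including singular ones.  For a common zero
    of rank three, the Grassmann-Cayley equations allow one to replace the vanishing
    D_i by nonzero vectors.  A common zero of rank two is a projection of a rank three
    configuration: its third coordinate z has to lie in the kernel of the liftability
    matrix if no D_i vanishes, which the lifting equations make large enough; and if
    some D_i vanish there are fewer linear conditions on z and one homogeneous
    Grassmann-Cayley equation, which has a nontrivial zero on a plane. *)

Require Import Defs.
From mathcomp Require Import all_boot all_order all_algebra.
From mathcomp Require Import mpoly complex reals.
From mathcomp Require Import ring lra zify.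
From mathcomp Require boolp classical_sets.

Set Implicit Arguments.
Unset Strict Implicit.
Unset Printing Implicit Defensive.

Import Order.TTheory GRing.Theory Num.Theory.

Local Open Scope ring_scope.

(** Why the cases divide by rank: along a curve of hexagons the corners and sides can be chosen one
    after another, except that the last side is forced to be the join of the last corner and the
    first. This succeeds as soon as two consecutive corners of the target differ, since the
    numbering can be rotated to make them the last and the first. If all corners coincided, their
    common vector would be orthogonal to every column; rank three rules this out.

    In rank two the columns have two rows [x], [y] of coordinates in a plane, and any third row [z]
    outside the span of [x] and [y] restores rank three. For the whole matroid the lifting minors
    have size 9 - 2 = 7, so the liftability matrix has a kernel of dimension at least three, one
    more than that span.

    Incidences along curves are solved by cross products, never by division, so the curves stay
    polynomial and are defined at every parameter. *)

Local Notation o0 := (ord0 : 'I_3).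
Local Notation o1 := (lift ord0 ord0 : 'I_3).
Local Notation o2 := (lift ord0 (lift ord0 ord0) : 'I_3).

(** * Hilbert's Nullstellensatz over an uncountable algebraically closed field *)

Definition is_ideal (A : comNzRingType) (I : A -> Prop) : Prop :=
  [/\ I 0, forall x y, I x -> I y -> I (x + y) & forall a x, I x -> I (a * x)].

Section IdealAvoiding.
Variables (A : comNzRingType) (J : A -> Prop) (f : A).
Hypotheses (idJ : is_ideal J) (fJ : forall m, ~ J (f ^+ m)).

(** Rabinowitsch's trick without a localization: such a [P] corresponds to a maximal ideal of the
    quotient by [J] with [f] inverted, and the last clause is the inverse of [g] there. *)
Lemma maximal_ideal_avoiding_powers : exists P : A -> Prop,
  [/\ is_ideal P, forall x, J x -> P x, forall m, ~ P (f ^+ m)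
    & forall g, ~ P g -> exists u m, P (g * u - f ^+ m)].
Proof.
pose good (X : A -> Prop) :=
  [/\ is_ideal X, forall x, J x -> X x & forall m, ~ X (f ^+ m)].
have goodJ : good J by [].
have [F FP totF|P [Pgood Pmax]] :=
    @classical_sets.Zorn_bigcup A (fun X => (forall x, ~ X x) \/ good X).
  case: (boolp.pselect (exists2 X, F X & exists x, X x)) => [[X FX [x Xx]]|none]; last first.
    by left=> x [X FX Xx]; apply: none; exists X => //; exists x.
  have Fgood Y y : F Y -> Y y -> good Y by move=> /FP[/(_ y)//|].
  right; split; first split.
  - by exists X => //; case: (Fgood X x FX Xx) => -[].
  - move=> a b [Y FY Ya] [Z FZ Zb].
    by case: (totF Y Z FY FZ) => sub; [exists Z|exists Y] => //;
      [case: (Fgood Z b FZ Zb)|case: (Fgood Y a FY Ya)] => -[_ addX _] _ _;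
      apply: addX => //; exact: sub.
  - move=> a b [Y FY Yb]; exists Y => //.
    by case: (Fgood Y b FY Yb) => -[_ _ mulY] _ _; exact: mulY.
  - by move=> y Jy; exists X => //; case: (Fgood X x FX Xx) => _ + _; exact.
  - by move=> m [Y FY Ym]; case: (Fgood Y _ FY Ym) => _ _ /(_ m).
case: Pgood => [P0|[idP JP fP]].
  exfalso; apply: (Pmax J); last by right.
  by split=> [x /P0//|JP]; apply: (P0 0); apply: JP; case: idJ.
exists P; split=> // g Pg.
have [P00 PD PM] := idP.
pose Q x := exists2 y, P y & exists u, x = y + g * u.
have PQ x : P x -> Q x by move=> Px; exists x => //; exists 0; rewrite mulr0 addr0.
have idQ : is_ideal Q.
  split=> [|_ _ [y Py [u ->]] [z Pz [v ->]]|a _ [y Py [u ->]]]; first exact: PQ.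
    by exists (y + z); [exact: PD|exists (u + v); ring].
  by exists (a * y); [exact: PM|exists (a * u); ring].
case: (boolp.pselect (exists m, Q (f ^+ m))) => [[m [y Py [u fmE]]]|none].
  by exists u, m; rewrite fmE opprD addrCA subrr addr0 -mulN1r; exact: PM.
exfalso; apply: (Pmax Q).
  split; first exact: PQ.
  by move=> QP; apply/Pg/QP; exists 0 => //; exists 1; rewrite mulr1 add0r.
by right; split=> // [x /JP/PQ|m Qm] //; apply: none; exists m.
Qed.

End IdealAvoiding.

(** Uncountability in the form in which it is used: every countable colouring has an infinite colour
    class, infinity being expressed by duplicate-free sequences of every length. *)
Definition has_big_fibers (T : eqType) : Prop :=
  forall c : T -> nat, exists n, forall N,
    exists s : seq T, [/\ uniq s, size s = N & forall x, x \in s -> c x = n].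

Section Nullstellensatz.
Variables (K : closedFieldType) (n : nat).
Hypothesis K_unc : has_big_fibers K.
Local Notation Pol := {mpoly K[n]}.

Lemma mpoly_bounded_dependent d : exists N, forall u : 'I_N -> Pol,
  (forall j, (msize (u j) <= d)%N) ->
  exists c : 'I_N -> K, (exists j, c j != 0) /\ \sum_(j < N) c j *: u j = 0.
Proof.
pose T : finType := 'X_{1..n < d}; exists #|T|.+1 => u ud.
pose M := \matrix_(j < #|T|.+1, t < #|T|) (u j)@_(val (enum_val t)).
have : \rank (kermx M) != 0%N.
  by rewrite mxrank_ker subn_eq0 -ltnNge ltnS rank_leq_col.
rewrite mxrank_eq0 => /rowV0Pn[c /sub_kermxP cM c0].
exists (c 0); split; first exact/rV0Pn.
apply/mpolyP => m; rewrite mcoeff0 raddf_sum /=.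
under eq_bigr do rewrite mcoeffZ.
have [md|md] := ltnP (mdeg m) d; last first.
  apply: big1 => j _; rewrite memN_msupp_eq0 ?mulr0 //.
  by apply: contraL md => /msize_mdeg_lt/leq_trans/(_ (ud j)); rewrite -ltnNge.
have /rowP/(_ (enum_rank (BMultinom md : T))) := cM.
rewrite !mxE => cM0; rewrite -[RHS]cM0; apply: eq_bigr => j _.
by rewrite mxE enum_rankK.
Qed.

Lemma prime_splits (P : Pol -> Prop) (x : Pol) (r : seq K) :
  ~ P 1 -> (forall a b, P (a * b) -> P a \/ P b) ->
  P (\prod_(a <- r) (x - a%:MP)) -> exists a, P (x - a%:MP).
Proof.
move=> P1 Pprime; elim: r => [|a r IHr]; first by rewrite big_nil.
by rewrite big_cons => /Pprime[Pa|/IHr//]; exists a.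
Qed.

(* Partial fractions: if every [x - a] divides a power of [f] modulo [P], then
   infinitely many of the cofactors [u a] live in one finite-dimensional space
   and a linear relation among them clears to a polynomial in [x] lying in [P]. *)
Lemma avoiding_ideal_has_value (P : Pol -> Prop) (f x : Pol) :
  is_ideal P -> (forall m, ~ P (f ^+ m)) ->
  (forall a b, P (a * b) -> P a \/ P b) ->
  (forall g, ~ P g -> exists u m, P (g * u - f ^+ m)) ->
  exists a, P (x - a%:MP).
Proof.
move=> [P0 PD PM] fP Pprime Pinv.
apply: boolp.contrapT => none.
have /boolp.choice[um umP] : forall a : K, exists um : Pol * nat,
    P ((x - a%:MP) * um.1 - f ^+ um.2).
  move=> a; have [|u [m um]] := Pinv (x - a%:MP); last by exists (u, m).
  by move=> Pa; apply: none; exists a.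
(* Colouring [a] by the exponent and the size of its cofactor makes both constant on an infinite
   set. *)
have [k kP] := K_unc (fun a => pickle ((um a).2, msize (um a).1)).
have [a0 a0k] : exists a0, pickle ((um a0).2, msize (um a0).1) = k.
  by have [[|a0 s] [_ // _ sP]] := kP 1%N; exists a0; apply: sP; exact: mem_head.
pose m := (um a0).2; pose d := msize (um a0).1.
have {}kP N : exists s : seq K, [/\ uniq s, size s = N &
    forall a, a \in s -> (um a).2 = m /\ msize (um a).1 = d].
  have [s [us ss sk]] := kP N; exists s; split=> // a /sk; rewrite -a0k.
  by move=> /(pcan_inj pickleK)[-> ->].
have [N lindep] := mpoly_bounded_dependent d.
have [s [us sN sP]] := kP N.
have sjP (j : 'I_N) : s`_j \in s by rewrite mem_nth ?sN.
have [j|c [[j0 cj0] cu]] := lindep (fun j => (um s`_j).1).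
  by have [_ ->] := sP _ (sjP j).
(* [h] is the numerator of the sum of the fractions [c j / ('X - s_j)]. At [s_j0] only the term of
   index [j0] survives, so [h] is nonzero. *)
pose others (j : 'I_N) : {poly K} := \prod_(i < N | i != j) ('X - (s`_i)%:P).
pose h := \sum_(j < N) c j *: others j.
have h0 : h != 0.
  apply/negP => /eqP/(congr1 (horner^~ s`_j0)); rewrite horner0 horner_sum.
  rewrite (bigD1 j0) //= big1 ?addr0 => [|j jj0]; last first.
    rewrite hornerZ horner_prod (bigD1 j0) 1?eq_sym //=.
    by rewrite hornerXsubC subrr mul0r mulr0.
  rewrite hornerZ horner_prod => /eqP; rewrite mulf_eq0 (negPf cj0) /=.
  apply/negP/prodf_neq0 => i ij0; rewrite hornerXsubC subr_eq0 nth_uniq ?sN //.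
  by rewrite eq_sym.
pose ev := horner_morph (fun a : K => mulrC x (mpolyC n a)).
have evXC a : ev ('X - a%:P) = x - a%:MP.
  by rewrite /ev rmorphB /= horner_morphX horner_morphC.
have evM a b : ev (a * b) = ev a * ev b by exact: rmorphM.
have evZ a g : ev (a *: g) = a *: ev g.
  by rewrite /ev -mul_polyC rmorphM /= horner_morphC mul_mpolyC.
have : P (f ^+ m * ev h).
  suff -> : f ^+ m * ev h = \sum_(j < N) (- (c j)%:MP * ev (others j))
      * ((x - (s`_j)%:MP) * (um s`_j).1 - f ^+ m).
    apply: (big_ind P) => // j _; apply: PM.
    by have [<- _] := sP _ (sjP j); exact: umP.
  pose W := ev (\prod_(i < N) ('X - (s`_i)%:P)).
  have WE (j : 'I_N) : W = (x - (s`_j)%:MP) * ev (others j).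
    by rewrite /W (bigD1 j) //= evM evXC.
  (* The subtracted product is zero by the linear relation; it supplies the terms [(x - s_j) u_j] of
     the congruences modulo [P]. *)
  transitivity (f ^+ m * ev h - W * \sum_(j < N) c j *: (um s`_j).1).
    by rewrite cu mulr0 subr0.
  have -> : ev h = \sum_(j < N) ev (c j *: others j) by exact: rmorph_sum.
  rewrite !mulr_sumr -sumrB; apply: eq_bigr => j _.
  rewrite evZ -!mul_mpolyC (WE j); ring.
case/Pprime => [/fP//|].
have [r ->] := closed_field_poly_normal h; rewrite evZ -mul_mpolyC.
have P1 : ~ P 1 by exact: (fP 0%N).
case/Pprime => [Pc|].
  apply: P1; rewrite -(mpolyC1 n K) -(mulVf (x := lead_coef h)) ?lead_coef_eq0 //.
  by rewrite mpolyCM; exact: PM.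
have -> : ev (\prod_(a <- r) ('X - a%:P)) = \prod_(a <- r) ev ('X - a%:P).
  exact: rmorph_prod.
by under eq_bigr do rewrite evXC; move/(prime_splits P1 Pprime).
Qed.

(** If no power of [f] lies in [J], a maximal ideal [P] avoiding these powers is prime, and every
    coordinate is congruent to a constant modulo [P]. These constants form a zero of [J], and every
    polynomial is congruent to its value there, so [f] would lie in [P]. *)
Theorem nullstellensatz (J : Pol -> Prop) (f : Pol) : is_ideal J ->
  (forall v : 'I_n -> K, (forall g, J g -> g.@[v] = 0) -> f.@[v] = 0) ->
  exists m, J (f ^+ m).
Proof.
move=> idJ fJ; apply: boolp.contrapT => none.
have [|P [[P0 PD PM] JP fP Pinv]] := @maximal_ideal_avoiding_powers _ J f idJ.
  by move=> m Jm; apply: none; exists m.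
have Pprime a b : P (a * b) -> P a \/ P b.
  move=> Pab; apply: boolp.contrapT => /boolp.not_orP[/Pinv[u [k ua]] /Pinv[v [l vb]]].
  apply: (fP (k + l)%N).
  have -> : f ^+ (k + l) = u * v * (a * b) - b * v * (a * u - f ^+ k)
                           - f ^+ k * (b * v - f ^+ l) by rewrite exprD; ring.
  by apply: (PD); [apply: (PD)|]; rewrite -?mulNr; apply: (PM).
have /boolp.choice[v vP] : forall i : 'I_n, exists a, P ('X_i - a%:MP).
  by move=> i; apply: (@avoiding_ideal_has_value P f).
have Pmul g h a b : P (g - a%:MP) -> P (h - b%:MP) -> P (g * h - (a * b)%:MP).
  move=> ga hb; have -> : g * h - (a * b)%:MP = h * (g - a%:MP) + a%:MP * (h - b%:MP).
    by rewrite mpolyCM; ring.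
  by apply: (PD); apply: (PM).
have Pval g : P (g - g.@[v]%:MP).
  elim/mpolyind: g => [|c m g _ _ IHg]; first by rewrite meval0 subrr.
  rewrite mevalD mpolyCD opprD addrACA; apply: (PD) IHg.
  rewrite mevalZ -mul_mpolyC; apply: (Pmul); first by rewrite subrr.
  rewrite mpolyXE_id rmorph_prod /=.
  apply: (big_ind2 (fun h a => P (h - a%:MP))) => [|? ? ? ?|i _]; first by rewrite subrr.
    exact: Pmul.
  rewrite rmorphXn /= mevalXU; elim: (m i) => [|k IHk]; first by rewrite !expr0 subrr.
  by rewrite !exprS; exact: Pmul.
have Jv g : J g -> g.@[v] = 0.
  move=> Jg; apply: boolp.contrapT => /eqP gv; apply: (fP 0%N).
  have -> : f ^+ 0 = (g.@[v]^-1)%:MP * g - (g.@[v]^-1)%:MP * (g - g.@[v]%:MP).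
    by rewrite mulrBr opprB addrC subrK -mpolyCM mulVf.
  by rewrite -mulNr; apply: (PD); apply: (PM) => //; exact: JP.
by apply: (fP 1%N); have := Pval f; rewrite fJ // subr0.
Qed.

End Nullstellensatz.

(** * Uncountability of the complex numbers *)

Section Uncountable.
Variable R : realType.

(** Cantor's nested intervals: the closed interval [ab] is cut down to one that misses [x]. Starting
    the right piece at the midpoint leaves a gap even when [x] is the point at one third. *)
Definition avoid_step (ab : R * R) (x : R) : R * R :=
  if x <= ab.1 + (ab.2 - ab.1) / 3 then (ab.1 + (ab.2 - ab.1) / 2, ab.2)
  else (ab.1, ab.1 + (ab.2 - ab.1) / 3).

Lemma avoid_stepP ab x : ab.1 < ab.2 ->
  let cd := avoid_step ab x in
  [/\ ab.1 <= cd.1, cd.2 <= ab.2, cd.1 < cd.2 & forall y, cd.1 <= y <= cd.2 -> y != x].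
Proof.
case: ab => a b /= ab; rewrite /avoid_step /=.
case: ifP => [|/negbT]; rewrite -?ltNge => h /=; split; try lra.
  by move=> y /andP[h1 h2]; apply/eqP => yx; lra.
by move=> y /andP[h1 h2]; apply/eqP => yx; lra.
Qed.

Lemma avoid_seqP s ab : ab.1 < ab.2 ->
  let cd := foldl avoid_step ab s in
  [/\ ab.1 <= cd.1, cd.2 <= ab.2, cd.1 < cd.2 & forall y, cd.1 <= y <= cd.2 -> y \notin s].
Proof.
elim: s ab => [|x s IHs] ab ab12 //=.
have [h1 h2 h3 h4] := avoid_stepP x ab12.
have [k1 k2 k3 k4] := IHs _ h3.
split=> //; [exact: le_trans k1|exact: le_trans h2|] => y /[dup] /k4 ys /andP[cy yd].
rewrite inE negb_or ys andbT; apply: h4.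
by rewrite (le_trans k1 cy) (le_trans yd k2).
Qed.

(** The intervals miss one finite sequence per stage, and the supremum of their left ends lies in
    all of them. *)
Lemma real_avoids_sequence_of_seqs (s : nat -> seq R) : exists x, forall n, x \notin s n.
Proof.
pose I n := iteri n (fun k ab => foldl avoid_step ab (s k)) (0, 1 : R).
have I12 n : (I n).1 < (I n).2.
  by elim: n => [|n IHn] /=; [exact: ltr01|have [] := avoid_seqP (s n) IHn].
have Imono n k : (I n).1 <= (I (n + k)%N).1 /\ (I (n + k)%N).2 <= (I n).2.
  elim: k => [|k [IH1 IH2]]; first by rewrite addn0.
  rewrite addnS /=; have [h1 h2 _ _] := avoid_seqP (s (n + k)%N) (I12 (n + k)%N).
  by split; [exact: le_trans h1|exact: le_trans IH2].
have Ile m n : (I m).1 <= (I n).2.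
  apply: (@le_trans _ _ (I (m + n)%N).1); first by have [] := Imono m n.
  apply: (@le_trans _ _ (I (m + n)%N).2); first exact: ltW.
  by rewrite addnC; have [] := Imono n m.
pose A : R -> Prop := fun x => exists n, x = (I n).1.
have supA : classical_sets.has_sup A.
  by split; [exists 0, 0%N|exists 1 => _ [n ->]; exact: (Ile n 0%N)].
exists (sup A) => n; have [_ _ _] := avoid_seqP (s n) (I12 n).
apply; rewrite -/(I n.+1).
apply/andP; split; first by apply: (sup_upper_bound supA); exists n.+1.
by apply: ge_sup; [by case: supA|move=> _ [k ->]; exact: (Ile k n.+1)].
Qed.

(** Finite fibres would exhaust the complex numbers by countably many finite sets; a real number
    different from all their real parts lies in none of them. *)
Lemma has_big_fibers_complex : has_big_fibers (complex R).
Proof.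
move=> c; apply: boolp.contrapT => none.
have fin n : exists s : seq (complex R), forall x, c x = n -> x \in s.
  apply: boolp.contrapT => inf; apply: none; exists n.
  elim=> [|N [s [us ss sc]]]; first by exists [::].
  have [x [cx xs]] : exists x, c x = n /\ x \notin s.
    apply: boolp.contrapT => nox; apply: inf; exists s => x cx.
    by apply/negPn/negP => xs; apply: nox; exists x.
  exists (x :: s); split=> [||y]; rewrite /= ?us ?xs ?ss // inE.
  by case/predU1P => [->|/sc].
have [s sP] := boolp.choice fin.
have [x xs] := real_avoids_sequence_of_seqs (fun n => [seq complex.Re z | z <- s n]).
have /negP := xs (c (real_complex R x)); apply.
by apply/mapP; exists (real_complex R x); first exact: sP.
Qed.

End Uncountable.

(** * Vectors of the projective plane *)

Section Vectors.
Variable P : comNzRingType.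
Implicit Types u v w : 'cV[P]_3.

Definition vec (a b c : P) : 'cV[P]_3 := \col_(i < 3) [:: a; b; c]`_i.

Definition dot u v : P := u o0 0 * v o0 0 + u o1 0 * v o1 0 + u o2 0 * v o2 0.

(** Both the join of two points and the meet of two lines, points and lines being identified through
    [dot]. *)
Definition cross u v : 'cV[P]_3 :=
  vec (u o1 0 * v o2 0 - u o2 0 * v o1 0)
      (u o2 0 * v o0 0 - u o0 0 * v o2 0)
      (u o0 0 * v o1 0 - u o1 0 * v o0 0).

Lemma vecE a b c :
  (vec a b c o0 0 = a) * (vec a b c o1 0 = b) * (vec a b c o2 0 = c).
Proof. by rewrite !mxE. Qed.

Lemma cV3P u v : u o0 0 = v o0 0 -> u o1 0 = v o1 0 -> u o2 0 = v o2 0 -> u = v.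
Proof.
move=> e0 e1 e2; apply/colP; case=> [[|[|[|//]]]] lt_i.
- by rewrite (_ : Ordinal lt_i = o0) //; apply: val_inj.
- by rewrite (_ : Ordinal lt_i = o1) //; apply: val_inj.
- by rewrite (_ : Ordinal lt_i = o2) //; apply: val_inj.
Qed.

Lemma det3E u v w : det3 u v w = dot (cross u v) w.
Proof.
rewrite /det3 (expand_det_row _ ord0) !big_ord_recl big_ord0 /cofactor.
rewrite !(expand_det_row _ ord0) !big_ord_recl !big_ord0 /cofactor.
rewrite !det_mx11 !mxE /= !(tnth_nth 0) /= /dot !vecE.
ring.
Qed.

End Vectors.

Ltac vec_ring := rewrite ?det3E /dot /cross ?vecE ?mxE /=; ring.

Section VectorIdentities.
Variable P : comNzRingType.
Implicit Types u v w q : 'cV[P]_3.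

Lemma crossvv u : cross u u = 0.
Proof. by apply: cV3P; vec_ring. Qed.

Lemma crossC u v : cross u v = - cross v u.
Proof. by apply: cV3P; vec_ring. Qed.

Lemma crossZl a u v : cross (a *: u) v = a *: cross u v.
Proof. by apply: cV3P; vec_ring. Qed.

Lemma crossZr a u v : cross u (a *: v) = a *: cross u v.
Proof. by apply: cV3P; vec_ring. Qed.

Lemma cross0v u : cross 0 u = 0.
Proof. by apply: cV3P; vec_ring. Qed.

Lemma crossv0 u : cross u 0 = 0.
Proof. by apply: cV3P; vec_ring. Qed.

Lemma crossDr u v w : cross u (v + w) = cross u v + cross u w.
Proof. by apply: cV3P; vec_ring. Qed.

Lemma crossDl u v w : cross (u + v) w = cross u w + cross v w.
Proof. by apply: cV3P; vec_ring. Qed.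

Lemma dotC u v : dot u v = dot v u.
Proof. vec_ring. Qed.

Lemma dotZr a u v : dot u (a *: v) = a * dot u v.
Proof. vec_ring. Qed.

Lemma dotZl a u v : dot (a *: u) v = a * dot u v.
Proof. vec_ring. Qed.

Lemma dotDr u v w : dot u (v + w) = dot u v + dot u w.
Proof. vec_ring. Qed.

Lemma dot0r u : dot u 0 = 0.
Proof. vec_ring. Qed.

Lemma dot0l u : dot 0 u = 0.
Proof. vec_ring. Qed.

Lemma dot_crossl u v : dot u (cross u v) = 0.
Proof. vec_ring. Qed.

Lemma dot_crossr u v : dot v (cross u v) = 0.
Proof. vec_ring. Qed.

Lemma triple_cross u v w : cross u (cross v w) = dot u w *: v - dot u v *: w.
Proof. by apply: cV3P; vec_ring. Qed.

Lemma cross_cross_common u v w : cross (cross u v) (cross v w) = det3 u v w *: v.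
Proof. by apply: cV3P; vec_ring. Qed.

Lemma cramer u v w q :
  det3 v w q *: u + det3 w u q *: v + det3 u v q *: w = det3 u v w *: q.
Proof. by apply: cV3P; vec_ring. Qed.

Lemma det3_scale a b c u v w :
  det3 (a *: u) (b *: v) (c *: w) = a * b * c * det3 u v w.
Proof. vec_ring. Qed.

End VectorIdentities.

Lemma map_vec (P Q : comNzRingType) (f : {rmorphism P -> Q}) a b c :
  map_mx f (vec a b c) = vec (f a) (f b) (f c).
Proof. by apply: cV3P; rewrite mxE !vecE. Qed.

Lemma map_cross (P Q : comNzRingType) (f : {rmorphism P -> Q}) u v :
  map_mx f (cross u v) = cross (map_mx f u) (map_mx f v).
Proof. by rewrite /cross map_vec !rmorphB !rmorphM !mxE. Qed.

Lemma map_dot (P Q : comNzRingType) (f : {rmorphism P -> Q}) u v :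
  f (dot u v) = dot (map_mx f u) (map_mx f v).
Proof. by rewrite /dot !rmorphD !rmorphM !mxE. Qed.

Lemma map_det3 (P Q : comNzRingType) (f : {rmorphism P -> Q}) u v w :
  f (det3 u v w) = det3 (map_mx f u) (map_mx f v) (map_mx f w).
Proof. by rewrite !det3E map_dot map_cross. Qed.

(** Stated over a domain because it is applied to polynomial vectors, where a nonzero [p] may still
    vanish at some parameters. *)
Lemma det3_orth_eq0 (P : idomainType) (p u v w : 'cV[P]_3) :
  p != 0 -> dot p u = 0 -> dot p v = 0 -> dot p w = 0 -> det3 u v w = 0.
Proof.
move=> p0 pu pv pw; apply/eqP; apply: contraNT p0 => d0; apply/eqP.
suff pd0 : det3 u v w *: p = 0.
  by apply/colP => k; move/colP/(_ k)/eqP: pd0; rewrite !mxE mulf_eq0 (negPf d0) => /eqP.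
have -> : det3 u v w *: p =
    dot p u *: cross v w + dot p v *: cross w u + dot p w *: cross u v.
  by apply: cV3P; vec_ring.
by rewrite pu pv pw !scale0r !addr0.
Qed.

Section FieldVectors.
Variable K : fieldType.
Implicit Types p s u v w : 'cV[K]_3.

Lemma det3_eq0_orth u v w : det3 u v w = 0 ->
  exists p, [/\ p != 0, dot p u = 0, dot p v = 0 & dot p w = 0].
Proof.
move=> /eqP/det0P[r r0 rM]; exists r^T; split; first by rewrite trmx_eq0.
- move/rowP/(_ o0): rM; rewrite /dot !mxE !big_ord_recl big_ord0 !mxE !(tnth_nth 0) /=.
  by rewrite addr0 addrA.
- move/rowP/(_ o1): rM; rewrite /dot !mxE !big_ord_recl big_ord0 !mxE !(tnth_nth 0) /=.
  by rewrite addr0 addrA.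
- move/rowP/(_ o2): rM; rewrite /dot !mxE !big_ord_recl big_ord0 !mxE !(tnth_nth 0) /=.
  by rewrite addr0 addrA.
Qed.

Lemma exists_orth2 u v : exists p, [/\ p != 0, dot p u = 0 & dot p v = 0].
Proof.
have [|p [p0 pu pv _]] := @det3_eq0_orth u v v; first by vec_ring.
by exists p.
Qed.

Lemma vec_neq0 u : u != 0 -> [\/ u o0 0 != 0, u o1 0 != 0 | u o2 0 != 0].
Proof.
move=> u0; apply/or3P; apply: contraNT u0; rewrite !negb_or !negbK.
by move=> /and3P[/eqP ? /eqP ? /eqP ?]; apply/eqP/cV3P; rewrite mxE.
Qed.

(** This makes incidence deformable: the vectors incident with [p] are parametrized by a free [w],
    which can be interpolated. *)
Lemma orth_cross p u : p != 0 -> dot p u = 0 -> exists w, u = cross p w.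
Proof.
move=> /vec_neq0[] pk; rewrite /dot => pu.
- exists (vec 0 (u o2 0 / p o0 0) (- u o1 0 / p o0 0)).
  apply: cV3P; rewrite !vecE; [|by field|by field].
  apply: (mulfI pk); have -> : p o0 0 * u o0 0 = - (p o1 0 * u o1 0 + p o2 0 * u o2 0).
    by apply/eqP; rewrite -subr_eq0 opprK addrA pu.
  by field.
- exists (vec (- u o2 0 / p o1 0) 0 (u o0 0 / p o1 0)).
  apply: cV3P; rewrite !vecE; [by field| |by field].
  apply: (mulfI pk); have -> : p o1 0 * u o1 0 = - (p o0 0 * u o0 0 + p o2 0 * u o2 0).
    by apply/eqP; rewrite -subr_eq0 -pu; apply/eqP; ring.
  by field.
- exists (vec (u o1 0 / p o2 0) (- u o0 0 / p o2 0) 0).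
  apply: cV3P; rewrite !vecE; [by field|by field|].
  apply: (mulfI pk); have -> : p o2 0 * u o2 0 = - (p o0 0 * u o0 0 + p o1 0 * u o1 0).
    by apply/eqP; rewrite -subr_eq0 -pu; apply/eqP; ring.
  by field.
Qed.

Lemma vec_dual u : u != 0 -> exists w, dot u w = 1.
Proof.
by move=> /vec_neq0[] uk;
  [exists (vec (u o0 0)^-1 0 0)|exists (vec 0 (u o1 0)^-1 0)|exists (vec 0 0 (u o2 0)^-1)];
  rewrite /dot !vecE; field.
Qed.

Lemma parallelP u v : u != 0 -> cross u v = 0 -> exists c, v = c *: u.
Proof.
move=> u0 uv; have [w uw] := vec_dual u0.
exists (dot w v); have := triple_cross w u v.
by rewrite uv crossv0 (dotC w u) uw scale1r => /esym/eqP; rewrite subr_eq0 => /eqP.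
Qed.

Lemma orth2_cross s u v : cross u v != 0 -> dot s u = 0 -> dot s v = 0 ->
  exists c, s = c *: cross u v.
Proof.
move=> uv su sv; apply: parallelP => //.
by rewrite crossC triple_cross su sv !scale0r subrr oppr0.
Qed.

Lemma parallel_trans p u v : p != 0 -> cross p u = 0 -> cross p v = 0 -> cross u v = 0.
Proof.
move=> p0 /(parallelP p0)[a ->] /(parallelP p0)[b ->].
by rewrite crossZl crossZr crossvv !scaler0.
Qed.

Lemma parallel_scale u v : u != 0 -> v != 0 -> cross u v = 0 ->
  exists2 c, c != 0 & v = c *: u.
Proof.
move=> u0 v0 /(parallelP u0)[c vE]; exists c => //.
by apply: contraNneq v0 => c0; rewrite vE c0 scale0r.
Qed.

Lemma cross_neq0l u v : cross u v != 0 -> u != 0.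
Proof. by apply: contraNneq => ->; rewrite cross0v. Qed.

Lemma cross_neq0r u v : cross u v != 0 -> v != 0.
Proof. by apply: contraNneq => ->; rewrite crossv0. Qed.

Lemma det3_neq0_cross u v w : det3 u v w != 0 -> cross u v != 0.
Proof. by apply: contraNneq => uv; rewrite det3E uv dot0l. Qed.

End FieldVectors.

Section Lerp.
Variables (K : comNzRingType) (m n : nat).
Implicit Types a b : 'M[K]_(m, n).

Definition lerp a b : 'M[{poly K}]_(m, n) :=
  map_mx polyC a + 'X *: map_mx polyC (b - a).

Lemma lerpE a b t : map_mx (horner_eval t) (lerp a b) = a + t *: (b - a).
Proof. by apply/matrixP => i j; rewrite !mxE /horner_eval !hornerE. Qed.

Lemma lerp0 a b : map_mx (horner_eval 0) (lerp a b) = a.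
Proof. by rewrite lerpE scale0r addr0. Qed.

Lemma lerp1 a b : map_mx (horner_eval 1) (lerp a b) = b.
Proof. by rewrite lerpE scale1r addrC subrK. Qed.

End Lerp.

(** * The closure of the realization space *)

Lemma evalX_X (K : fieldType) n (g : 'M[K]_(3, n)) :
  map_mx (meval (mxvec g ord0)) (X K n) = g.
Proof. by apply/matrixP => i j; rewrite !mxE mevalXU mxvecE. Qed.

Lemma evalX_comp (K : fieldType) n (f : {mpoly K[3 * n]}) (Y : 'M[{mpoly K[3 * n]}]_(3, n))
    (g : 'M[K]_(3, n)) :
  evalX (f \mPo [tuple mxvec Y ord0 k | k < 3 * n]) g
  = evalX f (map_mx (meval (mxvec g ord0)) Y).
Proof.
rewrite /evalX comp_mpoly_meval; apply: meval_eq => k.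
by rewrite tnth_mktuple -map_mxvec mxE.
Qed.

Lemma evalX_curve (K : fieldType) n (f : {mpoly K[3 * n]}) (G : 'M[{poly K}]_(3, n)) :
  exists F : {poly K}, forall t, evalX f (map_mx (horner_eval t) G) = F.[t].
Proof.
exists (\sum_(m <- msupp f) (f@_m)%:P * \prod_i mxvec G ord0 i ^+ m i) => t.
rewrite /evalX mevalE horner_sum; apply: eq_bigr => m _.
rewrite hornerM hornerC horner_prod; congr (_ * _); apply: eq_bigr => i _.
by rewrite horner_exp -map_mxvec mxE.
Qed.

Lemma poly_eq0_horner (K : numFieldType) (F : {poly K}) : (forall t, F.[t] = 0) -> F = 0.
Proof.
move=> F0; apply/eqP; apply: contraT => Fn0.
have := @max_poly_roots _ F [seq i%:R | i <- iota 0 (size F)] Fn0.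
rewrite size_map size_iota ltnn; apply.
  by apply/allP => x _; apply/eqP.
by rewrite map_inj_uniq ?iota_uniq // => i j /eqP; rewrite eqr_nat => /eqP.
Qed.

Section Variety.
Variables (K : numClosedFieldType) (n : nat) (M : matroid 'I_n).
Implicit Types (g : 'M[K]_(3, n)) (f : {mpoly K[3 * n]}).

(** The zero set of a polynomial is closed, so taking the closure of [Gamma] adds no condition. *)
Lemma matroid_idealE f :
  matroid_ideal K M f <-> forall h, Gamma M h -> evalX f h = 0.
Proof.
split=> [fV h Mh|fG g gV]; first by apply: fV => W _; apply.
apply: (gV (fun h => evalX f h = 0)) => //; exists (fun f' => f' = f) => h.
by split=> [fh f' ->|]; last exact.
Qed.

(* Membership in the matroid variety, tested on its ideal. *)
Definition inVM g := forall f, matroid_ideal K M f -> evalX f g = 0.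

Lemma Gamma_inVM g : Gamma M g -> inVM g.
Proof. by move=> Mg f /matroid_idealE; apply. Qed.

(** Membership is a closed condition. Along the curve a polynomial of the ideal becomes some [F],
    and [F * d] vanishes at every parameter, hence is zero. *)
Lemma inVM_curve (G : 'M[{poly K}]_(3, n)) (d : {poly K}) : d != 0 ->
  (forall t, d.[t] != 0 -> inVM (map_mx (horner_eval t) G)) ->
  forall t, inVM (map_mx (horner_eval t) G).
Proof.
move=> d0 dG t f fM; have [F FE] := evalX_curve f G.
suff : F * d = 0.
  by move/eqP; rewrite mulf_eq0 (negPf d0) orbF FE => /eqP ->; rewrite horner0.
apply: poly_eq0_horner => u; rewrite hornerM.
by have [->|du] := eqVneq d.[u] 0; rewrite ?mulr0 // -FE (dG u du f fM) mul0r.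
Qed.

Hypothesis Gamma_lin : forall g (A : 'M[K]_3) (c : 'rV[K]_n), Gamma M g ->
  A \in unitmx -> (forall j, c 0 j != 0) -> Gamma M (A *m g *m diag_mx c).

(** Singular [A] and vanishing entries of [c] are reached along the segment to the identity and to
    the constant row 1: the determinant times the product of the scalars is nonzero at parameter 1,
    hence at all but finitely many parameters. *)
Lemma inVM_lin g (A : 'M[K]_3) (c : 'rV[K]_n) : inVM g -> inVM (A *m g *m diag_mx c).
Proof.
have unit_case B (e : 'rV[K]_n) : B \in unitmx -> (forall j, e 0 j != 0) ->
    inVM g -> inVM (B *m g *m diag_mx e).
  move=> uB e0 gM f /matroid_idealE fM.
  pose mC := @mpolyC (3 * n) K.
  pose Y := map_mx mC B *m X K n *m map_mx mC (diag_mx e).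
  have YE h : map_mx (meval (mxvec h ord0)) Y = B *m h *m diag_mx e.
    rewrite /Y !map_mxM evalX_X; congr (_ *m _ *m _);
      by apply/matrixP => i j; rewrite !mxE /mC /= mevalC.
  rewrite -YE -evalX_comp; apply: gM; apply/matroid_idealE => h Mh.
  by rewrite evalX_comp YE; apply: fM; exact: Gamma_lin.
move=> gM.
pose G := lerp A 1%:M *m map_mx polyC g *m diag_mx (lerp c (const_mx 1)).
have GE t : map_mx (horner_eval t) G =
    (A + t *: (1%:M - A)) *m g *m diag_mx (c + t *: (const_mx 1 - c)).
  rewrite /G !map_mxM /= map_diag_mx !lerpE; congr (_ *m _ *m _).
  by apply/matrixP => i j; rewrite !mxE /= /horner_eval hornerC.
have -> : A *m g *m diag_mx c = map_mx (horner_eval 0) G.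
  by rewrite GE !scale0r !addr0.
pose d := \det (lerp A 1%:M) * \prod_j lerp c (const_mx 1) 0 j.
have dE t : d.[t] = \det (A + t *: (1%:M - A)) * \prod_j (c + t *: (const_mx 1 - c)) 0 j.
  rewrite /d hornerM horner_prod -[(\det _).[t]]/(horner_eval t _) -det_map_mx lerpE.
  by congr (_ * _); apply: eq_bigr => j _; rewrite -lerpE [RHS]mxE.
apply: (@inVM_curve G d) => [|t].
  apply/eqP => d0; have := dE 1; rewrite d0 horner0 !scale1r.
  rewrite !(addrC _ (_ - _)) !subrK det1 mul1r big1 => [/eqP|j _]; last by rewrite mxE.
  by rewrite eq_sym oner_eq0.
rewrite dE mulf_eq0 negb_or => /andP[uA /prodf_neq0 c0]; rewrite GE.
by apply: unit_case => //; [rewrite unitmxE unitfE|move=> j; exact: c0].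
Qed.

End Variety.

(** On natural numbers, with the labels shifted by one, so that statements about all triples can be
    checked by computation. *)
Definition aligned (i j k : nat) : bool :=
  has (fun s => [&& i.+1 \in s, j.+1 \in s & k.+1 \in s]) pascal_labels.

Lemma card_set3 (T : finType) (i j k : T) : uniq [:: i; j; k] -> #|[set i; j; k]| = 3%N.
Proof.
rewrite /= !inE negb_or !andbT => /andP[/andP[ij ik] jk].
by rewrite setUC cardsU1 cards2 ij !inE ![k == _]eq_sym (negPf ik) (negPf jk).
Qed.

Lemma mem_pascal_lines3 (i j k : 'I_9) : uniq [:: i; j; k] ->
  ([set i; j; k] \in pascal_lines) = aligned i j k.
Proof.
move=> /card_set3 c3; apply/mapP/hasP => -[s sP sE]; exists s => //.
  have mem (x : 'I_9) : x \in [set i; j; k] -> x.+1 \in s by rewrite sE inE.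
  by rewrite !mem ?inE ?eqxx ?orbT.
have ls : [set x : 'I_9 | x.+1 \in s] \in pascal_lines by apply/mapP; exists s.
apply/eqP; rewrite eqEcard (card_pascal_line ls) c3 leqnn andbT.
case/and3P: sE => si sj sk.
by apply/subsetP => x; rewrite !inE => /orP[/orP[]|] /eqP ->.
Qed.

Lemma mem_iota9 (i : 'I_9) : val i \in iota 0 9.
Proof. by rewrite mem_iota /=. Qed.

(** Reduces independence of pairs to triples: any two points belong to a basis. *)
Lemma exists_unaligned (i j : 'I_9) : i != j ->
  exists k : 'I_9, uniq [:: i; j; k] /\ ~~ aligned i j k.
Proof.
move=> ij.
suff /hasP[k] : has (fun k => uniq [:: val i; val j; k] && ~~ aligned i j k) (iota 0 9).
  rewrite mem_iota => /= k9 /andP[uk ak]; by exists (Ordinal k9).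
suff /allP/(_ i (mem_iota9 i))/allP/(_ j (mem_iota9 j)) :
  all (fun i => all (fun j => (i != j) ==>
     has (fun k => uniq [:: i; j; k] && ~~ aligned i j k) (iota 0 9)) (iota 0 9)) (iota 0 9).
  by rewrite -[val i == val j]/(i == j) ij.
by vm_compute.
Qed.

Section GammaPascal.
Variable K : fieldType.
Implicit Type g : 'M[K]_(3, 9).

Lemma free3 (u v w : 'cV[K]_3) : free [:: u; v; w] = (det3 u v w != 0).
Proof.
have fP := @freeP _ _ _ [tuple u; v; w]; apply/idP/idP => [/fP uvw|d0]; last first.
- apply/fP => k; rewrite !big_ord_recl big_ord0 addr0 /= => rel.
  have coef a x : dot x (k ord0 *: u + (k (lift ord0 ord0) *: v
      + k (lift ord0 (lift ord0 ord0)) *: w)) = a * det3 u v w -> a = 0.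
    by rewrite rel dot0r => /esym/eqP; rewrite mulf_eq0 (negPf d0) orbF => /eqP.
  case=> [[|[|[|//]]]] lt_i.
  - rewrite (_ : Ordinal lt_i = ord0); last exact: val_inj.
    by apply: (coef _ (cross v w)); vec_ring.
  - rewrite (_ : Ordinal lt_i = lift ord0 ord0); last exact: val_inj.
    by apply: (coef _ (cross w u)); vec_ring.
  - rewrite (_ : Ordinal lt_i = lift ord0 (lift ord0 ord0)); last exact: val_inj.
    by apply: (coef _ (cross u v)); vec_ring.
apply/negP => /eqP d0.
have [] := @det3_eq0_orth _ (vec (u ord0 0) (v ord0 0) (w ord0 0))
  (vec (u (lift ord0 ord0) 0) (v (lift ord0 ord0) 0) (w (lift ord0 ord0) 0))
  (vec (u (lift ord0 (lift ord0 ord0)) 0) (v (lift ord0 (lift ord0 ord0)) 0)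
       (w (lift ord0 (lift ord0 ord0)) 0)).
  by rewrite -d0; vec_ring.
move=> p []; rewrite /dot !vecE => /eqP p0 e0 e1 e2; apply: p0.
have /uvw p0 : \sum_(i < 3) p i 0 *: [tuple u; v; w]`_i = 0.
  by rewrite !big_ord_recl big_ord0 addr0 addrA; apply: cV3P; rewrite !mxE.
by apply: cV3P; rewrite p0 mxE.
Qed.

Lemma enum3 (A : {set 'I_9}) : #|A| = 3%N ->
  exists i j k, [/\ uniq [:: i; j; k], A = [set i; j; k] & enum A = [:: i; j; k]].
Proof.
rewrite cardE; have := enum_uniq (mem A); have := mem_enum (mem A).
case: (enum A) => [|i [|j [|k []]]] // memA uA _; exists i, j, k; split=> //.
by apply/setP => x; rewrite !inE -memA !inE orbA.
Qed.

(** Triples decide everything: sets of more than three points are dependent on both sides, by rank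
    and by dimension, and smaller sets extend to an unaligned triple. *)
Lemma GammaP g : Gamma pascal g <->
  forall i j k : 'I_9, uniq [:: i; j; k] ->
    (det3 (col i g) (col j g) (col k g) == 0) = aligned i j k.
Proof.
have depE (A : {set 'I_9}) : #|A| = 3%N -> dependent pascal A = (A \in pascal_lines).
  exact: pascal_dependent3.
split=> [Gg i j k u|Gg A _].
  have c3 := card_set3 u.
  have [i' [j' [k' [u' E enumE]]]] := enum3 c3.
  have := Gg _ (subsetT [set i; j; k]); rewrite depE // mem_pascal_lines3 //.
  have <- : det3 (col i g) (col j g) (col k g) != 0 = free [seq col x g | x <- enum [set i; j; k]].
    rewrite -free3; apply: perm_free.
    rewrite -[[:: col i g; _; _]]/(map (fun x => col x g) [:: i; j; k]).
    apply: perm_map; apply: uniq_perm => // [|x]; first exact: enum_uniq.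
    by rewrite mem_enum !inE orbA.
  by rewrite negbK => detP; apply/idP/idP => /detP.
have free_sub (B : {set 'I_9}) : A \subset B -> free [seq col x g | x <- enum B] ->
    free [seq col x g | x <- enum A].
  move=> AB; have /(perm_map (fun x => col x g))/perm_free -> :
      perm_eq (enum B) (enum A ++ enum (B :\: A)).
    apply: uniq_perm; rewrite ?enum_uniq // ?cat_uniq ?enum_uniq ?andbT /=.
      by apply/hasPn => x; rewrite !mem_enum inE => /andP[].
    move=> x; rewrite mem_cat !mem_enum inE; case xA: (x \in A) => //=.
    by rewrite (subsetP AB).
  by rewrite map_cat => /catl_free.
have [A3|] := eqVneq #|A| 3%N.
  have [i [j [k [u E enumE]]]] := enum3 A3.
  by rewrite depE // enumE /= free3 negbK Gg // E mem_pascal_lines3.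
rewrite neq_ltn => /orP[] cA; last first.
  rewrite /dependent subsetT /= /pascal_indep leqNgt cA /=; split=> // _.
  apply/negP => /eqP fA; have := dimvS (subvf <<[seq col x g | x <- enum A]>>).
  by rewrite fA size_map -cardE dimvf /dim /= muln1 leqNgt cA.
have [i [j [ij Aij]]] : exists i j : 'I_9, i != j /\ A \subset [set i; j].
  move: cA; rewrite cardE; have := mem_enum (mem A).
  case: (enum A) (enum_uniq (mem A)) => [|i [|j []]] // uA memA _.
  - by exists ord0, ord_max; split=> //; apply/subsetP => x; rewrite -memA.
  - exists i, (if i == ord0 then ord_max else ord0); split; first by case: (eqVneq i ord0) => [->|].
    by apply/subsetP => x; rewrite -memA !inE => /eqP ->; rewrite eqxx.
  - exists i, j; move: uA; rewrite /= inE andbT; split=> //.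
    by apply/subsetP => x; rewrite -memA !inE.
have [k [u nal]] := exists_unaligned ij.
have c3 := card_set3 u.
have [i' [j' [k' [u' E enumE]]]] := enum3 c3.
have AB : A \subset [set i; j; k] by apply: subset_trans Aij _; exact: subsetUl.
split=> [|/negP[]].
  rewrite /dependent subsetT /= /pascal_indep (ltnW cA) /= negbK => /card_pascal_line A3.
  by rewrite A3 in cA.
apply: free_sub AB _; rewrite enumE /= free3 Gg //.
by rewrite -mem_pascal_lines3 // -E mem_pascal_lines3.
Qed.

End GammaPascal.

Lemma col_lin (K : fieldType) (g : 'M[K]_(3, 9)) (A : 'M[K]_3) (c : 'rV[K]_9) j :
  col j (A *m g *m diag_mx c) = c 0 j *: (A *m col j g).
Proof.
apply/colP => i; rewrite mul_mx_diag !mxE mulrC; congr (_ * _).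
by apply: eq_bigr => k _; rewrite mxE.
Qed.

Lemma det3_mulmx (P : comNzRingType) (A : 'M[P]_3) u v w :
  det3 (A *m u) (A *m v) (A *m w) = \det A * det3 u v w.
Proof.
rewrite /det3 -det_mulmx; congr (\det _); apply/matrixP => i.
by case=> [[|[|[|//]]]] lt_j; rewrite ?mxE ?(tnth_nth 0) /= ?mxE; apply: eq_bigr => k _;
  rewrite !mxE !(tnth_nth 0).
Qed.

Section Pascal.
Variable K : numClosedFieldType.
Implicit Type g : 'M[K]_(3, 9).

Lemma Gamma_lin g (A : 'M[K]_3) (c : 'rV[K]_9) : Gamma pascal g ->
  A \in unitmx -> (forall j, c 0 j != 0) -> Gamma pascal (A *m g *m diag_mx c).
Proof.
move=> /GammaP Gg; rewrite unitmxE unitfE => uA c0; apply/GammaP => i j k u.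
by rewrite !col_lin det3_scale det3_mulmx -Gg // !mulf_eq0 !(negPf (c0 _)) (negPf uA).
Qed.

Definition inVM_linear := inVM_lin Gamma_lin.

(** The points 1 to 6 are [(1, t, t^2)] on a conic, for t = -3, -2, -1, 1, 0, 2. The points 7, 8, 9
    are the meets of 15 with 24, of 16 with 34 and of 26 with 35, collinear by Pascal's theorem. *)
Definition pascal_realization_coords : seq (int * int * int) :=
  [:: (1, - 3%:Z, 9); (1, - 2%:Z, 4); (1, - 1, 1); (1, 1, 1); (1, 0, 0); (1, 2, 4);
      (1, - 1, 3); (1, 5, 1); (- 1, 4, - 4%:Z)].

Definition pascal_realization : 'M[K]_(3, 9) :=
  \matrix_(i < 3, j < 9) let: (a, b, c) := nth (0, 0, 0) pascal_realization_coords j in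
    (nth 0 [:: a; b; c] i)%:~R.

Let det_coords (u v w : int * int * int) : int :=
  (u.1.2 * v.2 - u.2 * v.1.2) * w.1.1 + (u.2 * v.1.1 - u.1.1 * v.2) * w.1.2
  + (u.1.1 * v.1.2 - u.1.2 * v.1.1) * w.2.

Let coord := nth (0, 0, 0) pascal_realization_coords.

Lemma pascal_realizationP : Gamma pascal pascal_realization.
Proof.
have colE j : col j pascal_realization =
    vec (coord j).1.1%:~R (coord j).1.2%:~R (coord j).2%:~R.
  apply: cV3P; rewrite !mxE /= -/(coord j); by case: (coord j) => [[]].
apply/GammaP => i j k u; rewrite !colE.
have -> : det3 (vec (coord i).1.1%:~R (coord i).1.2%:~R (coord i).2%:~R)
  (vec (coord j).1.1%:~R (coord j).1.2%:~R (coord j).2%:~R)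
  (vec (coord k).1.1%:~R (coord k).1.2%:~R (coord k).2%:~R)
   = (det_coords (coord i) (coord j) (coord k))%:~R :> K.
  by rewrite det3E /dot /cross !vecE /det_coords; ring.
rewrite intr_eq0.
have : uniq [:: val i; val j; val k] by rewrite /= !inE !val_eqE; move: u; rewrite /= !inE.
suff /allP/(_ i (mem_iota9 i))/allP/(_ j (mem_iota9 j))/allP/(_ k (mem_iota9 k)) :
  all (fun i => all (fun j => all (fun k => uniq [:: i; j; k] ==>
     ((det_coords (coord i) (coord j) (coord k) == 0) == aligned i j k))
     (iota 0 9)) (iota 0 9)) (iota 0 9).
  by move=> /implyP H /H/eqP.
by vm_compute.
Qed.

(** The brackets of aligned triples vanish identically because of [p]. All others are nonzero at
    parameter 0, so their product [d] excludes only finitely many parameters, and elsewhere the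
    curve consists of realizations. *)
Lemma inVM_lines (G : 'M[{poly K}]_(3, 9)) :
  Gamma pascal (map_mx (horner_eval 0) G) ->
  (forall l, l \in pascal_labels -> exists2 p : 'cV[{poly K}]_3, p != 0 &
     forall x : 'I_9, x.+1 \in l -> dot p (col x G) = 0) ->
  forall t, inVM pascal (map_mx (horner_eval t) G).
Proof.
move=> /GammaP G0 Gl.
have detE t i j k : det3 (col i (map_mx (horner_eval t) G)) (col j (map_mx (horner_eval t) G))
    (col k (map_mx (horner_eval t) G)) = (det3 (col i G) (col j G) (col k G)).[t].
  by rewrite -[RHS]/(horner_eval t _) map_det3 !map_col.
pose T := {ijk : 'I_9 * 'I_9 * 'I_9 | uniq [:: ijk.1.1; ijk.1.2; ijk.2] &&
   ~~ aligned ijk.1.1 ijk.1.2 ijk.2}.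
pose d := \prod_(x : T) det3 (col (val x).1.1 G) (col (val x).1.2 G) (col (val x).2 G).
apply: (@inVM_curve _ _ _ G d).
  apply/prodf_neq0 => -[[[i j] k] /= /andP[u nal]] _ /=.
  by apply: contraNneq nal => d0; rewrite -G0 // detE d0 horner0.
move=> t; rewrite /d horner_prod => /prodf_neq0 dt.
apply: Gamma_inVM; apply/GammaP => i j k u; rewrite detE.
have [al|nal] := boolP (aligned i j k).
  have [l lP /and3P[li lj lk]] := hasP al.
  have [p p0 pl] := Gl l lP.
  by rewrite (det3_orth_eq0 p0) ?pl ?horner0 ?eqxx.
have xP : uniq [:: (i, j, k).1.1; (i, j, k).1.2; (i, j, k).2] &&
   ~~ aligned (i, j, k).1.1 (i, j, k).1.2 (i, j, k).2 by rewrite u.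
exact/negbTE/(dt (exist _ (i, j, k) xP)).
Qed.

End Pascal.

(** * Hexagons and their deformations *)

(* Points are numbered from 0: the sides are 1,5,3,4,2,6 and the diagonals 8,7,9. *)
Definition side_idx (i : nat) : 'I_9 := inord (nth 0 [:: 0; 4; 2; 3; 1; 5] i)%N.
Definition diagonal_idx (i : nat) : 'I_9 := inord (nth 0 [:: 7; 6; 8] i)%N.

Section Conf.
Variable P : comNzRingType.
Implicit Types s D p : nat -> 'cV[P]_3.

Definition hexagon s D : 'M[P]_(3, 9) :=
  \matrix_(r, j) (nth 0 [:: s 0; s 4; s 2; s 3; s 1; s 5; D 1; D 0; D 2]%N j) r 0.

Definition hexagon_sides (g : 'M[P]_(3, 9)) (i : nat) := col (side_idx i) g.
Definition hexagon_diagonals (g : 'M[P]_(3, 9)) (i : nat) := col (diagonal_idx i) g.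

(** The main diagonal joining the corners [i] and [i + 3], for [i < 3], each corner being the meet
    of its two sides; [(i + 5) %% 6] is the index before [i]. *)
Definition opposite_meet s i : 'cV[P]_3 :=
  cross (cross (s ((i + 5) %% 6)%N) (s i)) (cross (s (i + 2)%N) (s ((i + 3) %% 6)%N)).

Lemma col_hexagon s D j :
  col j (hexagon s D) = nth 0 [:: s 0; s 4; s 2; s 3; s 1; s 5; D 1; D 0; D 2]%N j.
Proof. by apply/colP => r; rewrite !mxE. Qed.

Lemma hexagonE (g : 'M[P]_(3, 9)) : hexagon (hexagon_sides g) (hexagon_diagonals g) = g.
Proof.
apply/matrixP => r j; rewrite mxE.
have <- : col j g = nth 0 (mkseq (fun i => col (inord i) g) 9) j.
  by rewrite nth_mkseq // inord_val.
by rewrite mxE.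
Qed.

Definition hex_incident s D p : Prop := forall i, (i < 6)%N ->
  [/\ p i != 0, dot (p i) (s i) = 0, dot (p (i.+1 %% 6)%N) (s i) = 0
    & dot (p i) (D (i %% 3)%N) = 0].

Lemma hexagon_lines s D p q : hex_incident s D p ->
  q != 0 -> (forall i, (i < 3)%N -> dot q (D i) = 0) ->
  forall l, l \in pascal_labels -> exists2 r, r != 0 &
     forall x : 'I_9, x.+1 \in l -> dot r (col x (hexagon s D)) = 0.
Proof.
move=> inc q0 qD l.
have [p0 a0 b0 c0] := inc 0%N isT; have [p1 a1 b1 c1] := inc 1%N isT.
have [p2 a2 b2 c2] := inc 2%N isT; have [p3 a3 b3 c3] := inc 3%N isT.
have [p4 a4 b4 c4] := inc 4%N isT; have [p5 a5 b5 c5] := inc 5%N isT.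
have D0 := qD 0%N isT; have D1 := qD 1%N isT; have D2 := qD 2%N isT.
rewrite !inE => /or4P[/eqP->|/eqP->|/eqP->|/or4P[]/eqP->];
  [exists (p 0%N)|exists (p 1%N)|exists (p 4%N)|exists (p 5%N)
  |exists (p 3%N)|exists (p 2%N)|exists q] => // x;
  rewrite col_hexagon !inE => /or3P[] /eqP[->] //=.
Qed.

(** Rotation of the hexagon, used to move a chosen edge to the closing position; the diagonals
    rotate with period 3. *)
Definition shift n k (t : nat -> 'cV[P]_3) i := t ((i + k) %% n)%N.

Lemma shiftK n k k' t i : (k + k' = n)%N -> (i < n)%N -> shift n k (shift n k' t) i = t i.
Proof. by move=> kk i_n; rewrite /shift modnDml -addnA kk modnDr modn_small. Qed.

Lemma shift3K k k' t i : (k + k' = 6)%N -> (i < 3)%N -> shift 3 k (shift 3 k' t) i = t i.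
Proof.
by move=> kk i_n; rewrite /shift modnDml -addnA kk -[6%N]/(2 * 3)%N addnC modnMDl modn_small.
Qed.

Lemma shiftS n k t i : shift n k t (i.+1 %% n)%N = t (((i + k) %% n).+1 %% n)%N.
Proof. by rewrite /shift modnDml -[in RHS]addn1 modnDml addn1 addSn. Qed.

Lemma shift3_mod6 k t i : shift 3 k t (i %% 3)%N = t ((i + k) %% 6 %% 3)%N.
Proof. by rewrite /shift modnDml modn_dvdm. Qed.

Lemma shift3S_mod6 k t i : shift 3 k t (i.+1 %% 3)%N = t (((i + k) %% 6).+1 %% 3)%N.
Proof.
rewrite /shift modnDml -[in RHS]addn1 -[in RHS]modnDml modn_dvdm //.
by rewrite modnDml addn1 addSn.
Qed.

Lemma hex_incident_shift k s D p : hex_incident s D p ->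
  hex_incident (shift 6 k s) (shift 3 k D) (shift 6 k p).
Proof.
move=> inc i i6; have j6 : ((i + k) %% 6 < 6)%N by rewrite ltn_mod.
by have [a b c d] := inc _ j6; split; rewrite ?shiftS ?shift3_mod6.
Qed.

End Conf.

(** * Curves of hexagons starting at a realization *)

Section Path.
Variable K : numClosedFieldType.
Local Notation ev t V := (map_mx (horner_eval t) V).
Implicit Types (V W P S D : 'cV[{poly K}]_3) (u v w p q s d : 'cV[K]_3).

(* A side of the target may vanish, whence no condition [c != 0] in [scaled_from]. *)
Definition scales_at t V v := exists2 c, c != 0 & ev t V = c *: v.
Definition scaled_from t V v := exists c, v = c *: ev t V.

(** Each end is the cross product of [V] with some vector; interpolating these vectors instead of
    the ends keeps the incidence with [V] at every parameter. *)
Lemma lerp_through_cross V u0 u1 (d0 := ev 0 V) (d1 := ev 1 V) :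
  d0 != 0 -> d1 != 0 -> dot d0 u0 = 0 -> dot d1 u1 = 0 ->
  exists W, [/\ dot V W = 0, ev 0 W = u0 & ev 1 W = u1].
Proof.
move=> d0n d1n /(orth_cross d0n)[w0 ->] /(orth_cross d1n)[w1 ->].
exists (cross V (lerp w0 w1)); split; first exact: dot_crossl.
  by rewrite map_cross lerp0.
by rewrite map_cross lerp1.
Qed.

(* Either the next corner moves freely on its diagonal and the side is the join of
   two corners, or the side moves freely about the current corner and meets the
   diagonal in the next one. *)
Lemma path_step P D p0 p0' s0 p1 p1' s1 (d0 := ev 0 D) (d1 := ev 1 D) :
  scales_at 0 P p0 -> scales_at 1 P p1 ->
  d0 != 0 -> d1 != 0 -> p0 != 0 -> p0' != 0 -> p1 != 0 -> p1' != 0 ->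
  dot p0' d0 = 0 -> dot p1' d1 = 0 ->
  dot p0 s0 = 0 -> dot p1 s1 = 0 -> dot p0' s0 = 0 -> dot p1' s1 = 0 ->
  s0 != 0 -> cross p0 p0' != 0 -> cross s0 d0 != 0 ->
  cross p1 p1' != 0 \/ cross s1 d1 != 0 ->
  exists P' S,
    [/\ dot P' D = 0, dot P S = 0 & dot P' S = 0] /\
    [/\ scales_at 0 P' p0', scales_at 1 P' p1', scales_at 0 S s0 & scaled_from 1 S s1].
Proof.
move=> [c0 c0n P0E] [c1 c1n P1E] d0n d1n p0n p0'n p1n p1'n p0d p1d ps0 ps1 p's0 p's1 s0n.
move=> pp0 sd0 [pp1|sd1].
  have [||||P' [DP' P'0 P'1]] := @lerp_through_cross D p0' p1' => //; try by rewrite dotC.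
  exists P', (cross P P'); split; first split.
  - by rewrite dotC.
  - exact: dot_crossl.
  - exact: dot_crossr.
  split.
  - by exists 1; rewrite ?oner_neq0 // P'0 scale1r.
  - by exists 1; rewrite ?oner_neq0 // P'1 scale1r.
  - have [|||e s0E] := @orth2_cross _ s0 p0 p0' => //; try by rewrite dotC.
    have e0 : e != 0 by apply: contraNneq s0n => e0; rewrite s0E e0 scale0r.
    exists (c0 / e); first by rewrite mulf_neq0 ?invr_eq0.
    by rewrite map_cross P0E P'0 crossZl s0E scalerA divfK.
  - have [|||e s1E] := @orth2_cross _ s1 p1 p1' => //; try by rewrite dotC.
    exists (e / c1); rewrite map_cross P1E P'1 crossZl scalerA divfK //.
have ev0n : ev 0 P != 0 by rewrite P0E scaler_eq0 negb_or c0n.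
have ev1n : ev 1 P != 0 by rewrite P1E scaler_eq0 negb_or c1n.
have [||||S [PS S0 S1]] := @lerp_through_cross P s0 s1 => //.
- by rewrite P0E dotZl ps0 mulr0.
- by rewrite P1E dotZl ps1 mulr0.
exists (cross S D), S; split; first split => //.
- by rewrite dotC dot_crossr.
- by rewrite dotC dot_crossl.
have scale s d p : cross s d != 0 -> p != 0 -> dot p s = 0 -> dot p d = 0 ->
    exists2 c, c != 0 & cross s d = c *: p.
  move=> sd pn ps pd; have [e pE] := orth2_cross sd ps pd.
  have e0 : e != 0 by apply: contraNneq pn => e0; rewrite pE e0 scale0r.
  by exists e^-1; rewrite ?invr_eq0 // pE scalerA mulVf // scale1r.
split.
- by have [c cn cE] := scale s0 d0 p0' sd0 p0'n p's0 p0d; exists c; rewrite // map_cross S0.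
- by have [c cn cE] := scale s1 d1 p1' sd1 p1'n p's1 p1d; exists c; rewrite // map_cross S1.
- by exists 1; rewrite ?oner_neq0 // S0 scale1r.
- by exists 1; rewrite S1 scale1r.
Qed.

Definition hex_data (s D p : nat -> 'cV[K]_3) : Prop :=
  [/\ hex_incident s D p, forall i, (i < 3)%N -> D i != 0
    & exists2 q, q != 0 & forall i, (i < 3)%N -> dot q (D i) = 0].

(** The target decides which alternative of [path_step] is taken at each edge, so the start has to
    allow both. *)
Definition hex_generic (s D p : nat -> 'cV[K]_3) : Prop := forall i, (i < 6)%N ->
  [/\ s i != 0, cross (p i) (p (i.+1 %% 6)%N) != 0 & cross (s i) (D (i.+1 %% 3)%N) != 0].

Lemma scales_at_neq0 t V v : v != 0 -> scales_at t V v -> V != 0.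
Proof.
move=> v0 [c c0 VE]; apply: contraNneq v0 => V0; move: VE.
by rewrite V0 map_mx0 => /esym/eqP; rewrite scaler_eq0 (negPf c0).
Qed.

(** Five applications of [path_step] draw everything except the last side, which must be the join of
    the corners 5 and 0. The last hypothesis makes the side 5 of the target a multiple of that
    join. *)
Lemma hex_path (s0 D0 p0 s1 D1 p1 : nat -> 'cV[K]_3) :
  hex_data s0 D0 p0 -> hex_generic s0 D0 p0 -> hex_data s1 D1 p1 ->
  (forall i, (i < 5)%N ->
     cross (p1 i) (p1 i.+1) != 0 \/ cross (s1 i) (D1 (i.+1 %% 3)%N) != 0) ->
  cross (p1 5%N) (p1 0%N) != 0 ->
  exists S D P : nat -> 'cV[{poly K}]_3, exists Q,
    [/\ hex_incident S D P, Q != 0 & forall i, (i < 3)%N -> dot Q (D i) = 0] /\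
    (forall i, (i < 3)%N -> ev 0 (D i) = D0 i /\ ev 1 (D i) = D1 i) /\
    (forall i, (i < 6)%N -> scales_at 0 (S i) (s0 i) /\ scaled_from 1 (S i) (s1 i)).
Proof.
move=> [inc0 D0n [q0 q0n q0D]] gen0 [inc1 D1n [q1 q1n q1D]] alt1 close1.
(* The common point of the diagonals moves on a segment. It may vanish in between:
   [lerp_through_cross] asks for nonzero values at the two ends only. *)
pose Q := lerp q0 q1.
have Qn : Q != 0 by apply: contraNneq q0n => Q0; rewrite -(lerp0 q0 q1) -/Q Q0 map_mx0.
have diag i : (i < 3)%N -> exists W, [/\ dot Q W = 0, ev 0 W = D0 i & ev 1 W = D1 i].
  by move=> i3; apply: lerp_through_cross; rewrite ?lerp0 ?lerp1 ?q0D ?q1D.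
have [W0 [QW0 W00 W01]] := diag 0%N isT.
have [W1 [QW1 W10 W11]] := diag 1%N isT.
have [W2 [QW2 W20 W21]] := diag 2%N isT.
pose D i := nth 0 [:: W0; W1; W2] i.
have DE i : (i < 3)%N -> ev 0 (D i) = D0 i /\ ev 1 (D i) = D1 i.
  by case: i => [|[|[|//]]].
have [P0 [P0D P00 P01]] : exists P, [/\ dot (D 0%N) P = 0, ev 0 P = p0 0%N & ev 1 P = p1 0%N].
  have [_ _ _ z0] := inc0 0%N isT; have [_ _ _ z1] := inc1 0%N isT.
  by apply: lerp_through_cross; rewrite ?W00 ?W01 ?D0n ?D1n // dotC.
have sP00 : scales_at 0 P0 (p0 0%N) by exists 1; rewrite ?oner_neq0 // scale1r.
have sP01 : scales_at 1 P0 (p1 0%N) by exists 1; rewrite ?oner_neq0 // scale1r.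
have step i P : (i < 5)%N -> scales_at 0 P (p0 i) -> scales_at 1 P (p1 i) ->
    exists P' S, [/\ dot P' (D (i.+1 %% 3)%N) = 0, dot P S = 0 & dot P' S = 0] /\
    [/\ scales_at 0 P' (p0 i.+1), scales_at 1 P' (p1 i.+1), scales_at 0 S (s0 i)
      & scaled_from 1 S (s1 i)].
  move=> i5 h0 h1; have i6 : (i < 6)%N by exact: ltnW.
  have j3 : (i.+1 %% 3 < 3)%N by rewrite ltn_mod.
  have [E0 E1] := DE _ j3; have jE : (i.+1 %% 6)%N = i.+1 by rewrite modn_small.
  have [a0 b0 c0 _] := inc0 i i6; have [a0' _ _ d0'] := inc0 i.+1 i5.
  have [a1 b1 c1 _] := inc1 i i6; have [a1' _ _ d1'] := inc1 i.+1 i5.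
  have [g1 g2 g3] := gen0 i i6; rewrite jE in c0 c1 g2.
  by apply: (@path_step _ _ (p0 i) (p0 i.+1) (s0 i) (p1 i) (p1 i.+1) (s1 i));
    rewrite ?E0 ?E1 ?D0n ?D1n //; exact: alt1.
have [P1 [S0 [[x1 y1 z1] [sP10 sP11 sS00 sS01]]]] := step 0%N P0 isT sP00 sP01.
have [P2 [S1 [[x2 y2 z2] [sP20 sP21 sS10 sS11]]]] := step 1%N P1 isT sP10 sP11.
have [P3 [S2 [[x3 y3 z3] [sP30 sP31 sS20 sS21]]]] := step 2%N P2 isT sP20 sP21.
have [P4 [S3 [[x4 y4 z4] [sP40 sP41 sS30 sS31]]]] := step 3%N P3 isT sP30 sP31.
have [P5 [S4 [[x5 y5 z5] [sP50 sP51 sS40 sS41]]]] := step 4%N P4 isT sP40 sP41.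
pose S5 := cross P5 P0.
have [sS50 sS51] : scales_at 0 S5 (s0 5%N) /\ scaled_from 1 S5 (s1 5%N).
  have [c0 c0n P50] := sP50; have [c1 c1n P51] := sP51.
  have [_ b0 d0 _] := inc0 5%N isT; have [_ b1 d1 _] := inc1 5%N isT.
  have [s50 cr0 _] := gen0 5%N isT.
  split.
    have [|||e s0E] := @orth2_cross _ (s0 5%N) (p0 5%N) (p0 0%N) => //; try by rewrite dotC.
    have e0 : e != 0 by apply: contraNneq s50 => e0; rewrite s0E e0 scale0r.
    exists (c0 / e); first by rewrite mulf_neq0 ?invr_eq0.
    by rewrite map_cross P50 P00 crossZl s0E scalerA divfK.
  have [|||e s1E] := @orth2_cross _ (s1 5%N) (p1 5%N) (p1 0%N) => //; try by rewrite dotC.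
  by exists (e / c1); rewrite map_cross P51 P01 crossZl scalerA divfK.
exists (nth 0 [:: S0; S1; S2; S3; S4; S5]), D, (nth 0 [:: P0; P1; P2; P3; P4; P5]), Q.
split; first split => //.
- have Pn i P (i6 : (i < 6)%N) : scales_at 0 P (p0 i) -> P != 0.
    by apply: scales_at_neq0; case: (inc0 i i6).
  case=> [|[|[|[|[|[|//]]]]]] _ /=; split => //; rewrite ?(dotC P0 W0) //.
  + exact: (Pn 0%N).
  + exact: (Pn 1%N).
  + exact: (Pn 2%N).
  + exact: (Pn 3%N).
  + exact: (Pn 4%N).
  + exact: (Pn 5%N).
  + exact: dot_crossl.
  + exact: dot_crossr.
- by case=> [|[|[|//]]].
by split=> //; case=> [|[|[|[|[|[|//]]]]]].
Qed.

Lemma hex_data_shift k (s D p : nat -> 'cV[K]_3) : hex_data s D p ->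
  hex_data (shift 6 k s) (shift 3 k D) (shift 6 k p).
Proof.
case=> inc D0 [q q0 qD]; split; first exact: hex_incident_shift.
  by move=> i _; apply: D0; rewrite ltn_mod.
by exists q => // i _; apply: qD; rewrite ltn_mod.
Qed.

Lemma hex_generic_shift k (s D p : nat -> 'cV[K]_3) : hex_generic s D p ->
  hex_generic (shift 6 k s) (shift 3 k D) (shift 6 k p).
Proof.
move=> gen i i6; have j6 : ((i + k) %% 6 < 6)%N by rewrite ltn_mod.
by have [a b c] := gen _ j6; split; rewrite ?shift3S_mod6 ?shiftS.
Qed.

Lemma Gamma_scale (g h : 'M[K]_(3, 9)) : Gamma pascal g ->
  (forall j, exists2 c, c != 0 & col j h = c *: col j g) -> Gamma pascal h.
Proof.
move=> /GammaP Gg hg; apply/GammaP => i j k u.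
have [[a a0 ->] [b b0 ->]] := (hg i, hg j); have [c c0 ->] := hg k.
by rewrite det3_scale -Gg // !mulf_eq0 (negPf a0) (negPf b0) (negPf c0).
Qed.

Lemma inVM_scale (g h : 'M[K]_(3, 9)) : inVM pascal g ->
  (forall j, exists c, col j h = c *: col j g) -> inVM pascal h.
Proof.
move=> Vg /fin_all_exists[c hg].
have -> : h = 1%:M *m g *m diag_mx (\row_j c j).
  apply/matrixP => i j; rewrite mul1mx mul_mx_diag !mxE mulrC.
  by have /colP/(_ i) := hg j; rewrite !mxE.
exact: inVM_linear.
Qed.

End Path.

Section Hexagons.
Variable K : numClosedFieldType.
Implicit Types (s D p : nat -> 'cV[K]_3).

Lemma hexagon_colP (P Q : comNzRingType) (R : 'cV[P]_3 -> 'cV[Q]_3 -> Prop)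
    (s D : nat -> 'cV[P]_3) (s' D' : nat -> 'cV[Q]_3) :
  (forall i, (i < 6)%N -> R (s i) (s' i)) -> (forall i, (i < 3)%N -> R (D i) (D' i)) ->
  forall j, R (col j (hexagon s D)) (col j (hexagon s' D')).
Proof.
move=> Rs RD j; rewrite !col_hexagon.
by case: j => [[|[|[|[|[|[|[|[|[|//]]]]]]]]] lt_j] /=; (exact: Rs || exact: RD).
Qed.

Lemma realization_hex_data : exists s D p,
  [/\ hexagon s D = pascal_realization K, hex_data s D p & hex_generic s D p].
Proof.
pose g := pascal_realization K.
have /GammaP Gg : Gamma pascal g by exact: pascal_realizationP.
pose s := hexagon_sides g; pose D := hexagon_diagonals g.
pose p i := cross (s ((i + 5) %% 6)%N) (s i).
have si i : (i < 6)%N -> s i = col (inord (nth 0 [:: 0; 4; 2; 3; 1; 5] i)%N) g by [].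
have det0 i j k : (i < 9)%N -> (j < 9)%N -> (k < 9)%N -> uniq [:: i; j; k] ->
   (det3 (col (inord i) g) (col (inord j) g) (col (inord k) g) == 0) = aligned i j k.
  move=> i9 j9 k9 u; rewrite Gg ?inordK //.
  by move: u; rewrite /= !inE -!val_eqE /= !inordK.
have nonpar i j : (i < 9)%N -> (j < 9)%N -> i != j ->
    cross (col (inord i) g) (col (inord j) g) != 0.
  move=> i9 j9 ij; have [|k [u al]] := @exists_unaligned (inord i) (inord j).
    by rewrite -val_eqE /= !inordK.
  by apply: (@det3_neq0_cross _ _ _ (col k g)); rewrite Gg.
have p0 i : (i < 6)%N -> p i != 0.
  by case: i => [|[|[|[|[|[|//]]]]]] _; apply: nonpar.
exists s, D, p; split; first exact: hexagonE.
  split.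
  - move=> i i6; split.
    + exact: p0.
    + by rewrite dotC dot_crossr.
    + rewrite dotC /p.
      have -> : ((i.+1 %% 6 + 5) %% 6)%N = i by rewrite modnDml addSnnS modnDr modn_small.
      exact: dot_crossl.
    + rewrite /p -det3E; case: i i6 => [|[|[|[|[|[|//]]]]]] _;
      by apply/eqP; rewrite det0.
  - by case=> [|[|[|//]]] _; [apply: (@cross_neq0l _ _ (D 1%N))|apply: (@cross_neq0l _ _ (D 0%N))
      |apply: (@cross_neq0l _ _ (D 0%N))]; apply: nonpar.
  - have [|q [q0 qa qb qc]] := @det3_eq0_orth _ (D 0%N) (D 1%N) (D 2%N).
      by apply/eqP; rewrite det0.
    by exists q => //; case=> [|[|[|//]]].
move=> i i6; split.
- have := p0 _ i6; exact: cross_neq0r.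
- have -> : p (i.+1 %% 6)%N = cross (s i) (s (i.+1 %% 6)%N).
    rewrite /p modnDml addSnnS modnDr modn_small //.
  rewrite cross_cross_common scaler_eq0 negb_or (cross_neq0r (p0 i i6)) andbT.
  by case: i i6 => [|[|[|[|[|[|//]]]]]] _; rewrite det0.
- by case: i i6 => [|[|[|[|[|[|//]]]]]] _; apply: nonpar.
Qed.

(** Rotating by [k + 1] turns the edge from corner [k] to the next into the closing edge from 5 to
    0; the curve is then rotated back by [m']. *)
Lemma inVM_hex_transversal s D p k : hex_data s D p ->
  (forall i, (i < 6)%N ->
     cross (p i) (p (i.+1 %% 6)%N) != 0 \/ cross (s i) (D (i.+1 %% 3)%N) != 0) ->
  (k < 6)%N -> cross (p k) (p (k.+1 %% 6)%N) != 0 ->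
  inVM pascal (hexagon s D).
Proof.
move=> data alt k6 close.
have [s0 [D0 [p0 [g0E data0 gen0]]]] := realization_hex_data.
pose m := k.+1; pose m' := (6 - k.+1)%N.
have mm : (m + m' = 6)%N by rewrite subnKC.
have [||S [E [P [Q [[inc Qn QE] [EE SE]]]]]] :=
    hex_path (hex_data_shift m data0) (hex_generic_shift m gen0) (hex_data_shift m data).
- move=> i i5; have j6 : ((i + m) %% 6 < 6)%N by rewrite ltn_mod.
  have := alt _ j6; rewrite shift3S_mod6 -shiftS.
  by rewrite (modn_small (m := i.+1)).
- by rewrite /shift add0n addnC addSnnS modnDr (modn_small k6).
pose S' := shift 6 m' S; pose E' := shift 3 m' E.
have inc' := hex_incident_shift m' inc.
have QE' i : (i < 3)%N -> dot Q (E' i) = 0 by move=> i3; apply: QE; rewrite ltn_mod.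
have lines := hexagon_lines inc' Qn QE'.
have SE' i : (i < 6)%N -> scales_at 0 (S' i) (s0 i) /\ scaled_from 1 (S' i) (s i).
  move=> i6; have := SE ((i + m') %% 6)%N; rewrite ltn_mod => /(_ isT).
  by rewrite -!/(shift 6 m' _ i) !shiftK // addnC.
have EE' i : (i < 3)%N -> map_mx (horner_eval 0) (E' i) = D0 i /\
    map_mx (horner_eval 1) (E' i) = D i.
  move=> i3; have := EE ((i + m') %% 3)%N; rewrite ltn_mod => /(_ isT).
  by rewrite -!/(shift 3 m' _ i) !shift3K // addnC.
have Gcurve : Gamma pascal (map_mx (horner_eval 0) (hexagon S' E')).
  apply: (Gamma_scale (pascal_realizationP K)) => j; rewrite -g0E -map_col.
  move: j; apply: (hexagon_colP (R := fun V v => exists2 c, c != 0 &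
    map_mx (horner_eval 0) V = c *: v)) => i i_n.
    by have [] := SE' i i_n.
  by exists 1; rewrite ?oner_neq0 // scale1r; have [] := EE' i i_n.
apply: (inVM_scale (inVM_lines Gcurve lines 1)) => j; rewrite -map_col.
move: j; apply: (hexagon_colP (R := fun v V => exists c,
  v = c *: map_mx (horner_eval 1) V)) => i i_n; first by have [] := SE' i i_n.
by exists 1; rewrite scale1r; have [] := EE' i i_n.
Qed.

End Hexagons.

(** * Degenerate hexagons: coincident corners and vanishing diagonals *)

Section Fill.
Variable K : numClosedFieldType.
Implicit Types (s D p n m : nat -> 'cV[K]_3) (g : 'M[K]_(3, 9)).

(* A side joining two coincident corners can be rotated about them, which makes it
   transversal to the next diagonal. *)
Lemma inVM_hex s D p k : hex_data s D p -> (k < 6)%N ->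
  cross (p k) (p (k.+1 %% 6)%N) != 0 -> inVM pascal (hexagon s D).
Proof.
move=> data k6 pk; have [inc Dn [q qn qD]] := data.
have /boolp.choice[y yP] : forall i, exists y, (i < 6)%N ->
    [/\ dot (p i) y = 0, dot (p (i.+1 %% 6)%N) y = 0 &
      cross (p i) (p (i.+1 %% 6)%N) != 0 \/
      forall t, t != 0 -> cross (s i + t *: y) (D (i.+1 %% 3)%N) != 0].
  move=> i; have [i6|] := boolP (i < 6)%N; last by exists 0.
  have [pp|] := eqVneq (cross (p i) (p (i.+1 %% 6)%N)) 0; last first.
    by move=> pp; exists 0 => _; split; rewrite ?dot0r //; left.
  have [pn _ _ _] := inc i i6.
  have [pn' _ _] := inc (i.+1 %% 6)%N (@ltn_pmod i.+1 6 isT).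
  rewrite modn_dvdm // => pD'.
  have [c c0 p'E] := parallel_scale pn pn' pp.
  have pD : dot (p i) (D (i.+1 %% 3)%N) = 0.
    by move/eqP: pD'; rewrite p'E dotZl mulf_eq0 (negPf c0) => /eqP.
  have [sD|sD] := eqVneq (cross (s i) (D (i.+1 %% 3)%N)) 0; last first.
    exists 0 => _; split; rewrite ?dot0r //; right => t _.
    by rewrite scaler0 addr0.
  (* The side is rotated in the direction [cross (p i) w], whose cross product with the diagonal is
     [- p i], hence nonzero. *)
  have [w Dw] := vec_dual (Dn (i.+1 %% 3)%N (@ltn_pmod i.+1 3 isT)).
  exists (cross (p i) w) => _; split.
  - exact: dot_crossl.
  - by rewrite p'E dotZl dot_crossl mulr0.
  - right=> t tn; rewrite crossDl crossZl sD add0r crossC triple_cross Dw dotC pD.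
    by rewrite scale0r subr0 scale1r scalerN oppr_eq0 scaler_eq0 negb_or tn.
pose G := lerp (hexagon s D) (hexagon (fun i => s i + y i) D).
have GE t : map_mx (horner_eval t) G = hexagon (fun i => s i + t *: y i) D.
  apply/matrixP => r j; rewrite lerpE.
  rewrite !mxE; move: j; case=> [[|[|[|[|[|[|[|[|[|//]]]]]]]]] lt_j] /=;
    rewrite ?mxE; ring.
have -> : hexagon s D = map_mx (horner_eval 0) G by rewrite lerp0.
apply: (@inVM_curve _ _ _ G 'X); first by rewrite polyX_eq0.
move=> t; rewrite hornerX => tn; rewrite GE.
apply: (@inVM_hex_transversal _ _ _ p k) => //.
  split=> //; last by exists q.
  move=> i i6; have [a b c d] := inc i i6; have [y1 y2 _] := yP i i6.
  by split=> //; rewrite dotDr dotZr ?y1 ?y2 mulr0 addr0.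
move=> i i6; have [_ _ [h|h]] := yP i i6; [by left|right; exact: h].
Qed.

(* If one of the meets vanishes, the corresponding new diagonal can be chosen through
   the intersection of the other two. *)
Lemma fill_diagonals D n m :
  (forall i, (i < 3)%N -> dot (n i) (D i) = 0 /\ dot (m i) (D i) = 0) ->
  let w i := if D i == 0 then cross (n i) (m i) else D i in
  det3 (w 0%N) (w 1%N) (w 2%N) = 0 ->
  exists D', [/\ forall i, (i < 3)%N -> [/\ D' i != 0, dot (n i) (D' i) = 0 & dot (m i) (D' i) = 0],
     forall i, (i < 3)%N -> D i != 0 -> D' i = D i &
     exists2 q, q != 0 & forall i, (i < 3)%N -> dot q (D' i) = 0].
Proof.
move=> nmD w w0.
case: (boolp.pselect (exists2 i, (i < 3)%N & w i = 0)) => [[i0 i03 wi0]|none]; last first.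
  exists w; split.
  - move=> i i3; split; first by apply/eqP => wi; apply: none; exists i.
      by rewrite /w; case: eqP => _; [exact: dot_crossl|have [] := nmD i i3].
    by rewrite /w; case: eqP => _; [exact: dot_crossr|have [] := nmD i i3].
  - by move=> i i3 Di; rewrite /w (negPf Di).
  - have [q [q0 h0 h1 h2]] := det3_eq0_orth w0.
    by exists q => //; case=> [|[|[|//]]].
have /boolp.choice[E EP] : forall i, exists e, (i < 3)%N ->
    [/\ e != 0, dot (n i) e = 0, dot (m i) e = 0 & D i != 0 -> e = D i].
  move=> i; have [Di|Di] := eqVneq (D i) 0; last first.
    by exists (D i) => i3; split=> //; have [] := nmD i i3.
  have [e [e0 en em]] := exists_orth2 (n i) (m i).
  by exists e => _; split=> //; rewrite dotC.
have [q [q0 q1 q2]] := exists_orth2 (E (i0.+1 %% 3)%N) (E (i0.+2 %% 3)%N).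
have Di0 : D i0 = 0 by move: wi0; rewrite /w; case: eqP.
have nm0 : cross (n i0) (m i0) = 0 by move: wi0; rewrite /w Di0 eqxx.
(* Since [n i0] and [m i0] have zero cross product, incidence with them and with [q] amounts to at
   most two linear conditions on [e]. *)
have [e [e0 ne me qe]] : exists e, [/\ e != 0, dot (n i0) e = 0, dot (m i0) e = 0 & dot q e = 0].
  have [n0|nn] := eqVneq (n i0) 0.
    have [e [en em eq]] := exists_orth2 (m i0) q.
    by exists e; rewrite n0 dot0l (dotC (m _)) (dotC q).
  have [e [en em eq]] := exists_orth2 (n i0) q.
  have [c ->] := parallelP nn nm0.
  by exists e; rewrite dotZl (dotC (n _)) (dotC q) em mulr0.
exists (fun i => if i == i0 then e else E i); split.
- by move=> i i3; have [->|_] := eqVneq i i0; [split|have [? ? ? _] := EP i i3; split].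
- move=> i i3 Di; have [ii|_] := eqVneq i i0; first by rewrite ii Di0 eqxx in Di.
  by have [_ _ _ ->] := EP i i3.
- exists q => // i i3; case: eqP => // /eqP.
  clear Di0 wi0 nm0 ne me; case: i0 i03 q1 q2 => [|[|[|//]]] _ q1 q2;
  by case: i i3 => [|[|[|//]]].
Qed.

(** The vanishing diagonals are filled in first and recovered at the end by scaling their columns by
    zero. The hypothesis on [q] is rank three, and excludes that all corners are proportional. *)
Lemma inVM_rank3 s D :
  (forall i, (i < 6)%N -> det3 (s ((i + 5) %% 6)%N) (s i) (D (i %% 3)%N) = 0) ->
  (let w i := if D i == 0 then opposite_meet s i else D i in
   det3 (w 0%N) (w 1%N) (w 2%N) = 0) ->
  (forall q, (forall j, dot q (col j (hexagon s D)) = 0) -> q = 0) ->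
  inVM pascal (hexagon s D).
Proof.
move=> lines w0 span.
pose n i := cross (s ((i + 5) %% 6)%N) (s i).
pose m i := cross (s (i + 2)%N) (s ((i + 3) %% 6)%N).
have nmD i : (i < 3)%N -> dot (n i) (D i) = 0 /\ dot (m i) (D i) = 0.
  rewrite /n /m -!det3E; case: i => [|[|[|//]]] _.
  - by split; [exact: (lines 0%N)|exact: (lines 3%N)].
  - by split; [exact: (lines 1%N)|exact: (lines 4%N)].
  - by split; [exact: (lines 2%N)|exact: (lines 5%N)].
have [D' [D'P D'E [q q0 qD]]] := fill_diagonals nmD w0.
have D'lines i : (i < 6)%N -> det3 (s ((i + 5) %% 6)%N) (s i) (D' (i %% 3)%N) = 0.
  rewrite det3E; move: i => [|[|[|[|[|[|//]]]]]] _.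
  - by have [] := D'P 0%N isT.
  - by have [] := D'P 1%N isT.
  - by have [] := D'P 2%N isT.
  - by have [] := D'P 0%N isT.
  - by have [] := D'P 1%N isT.
  - by have [] := D'P 2%N isT.
have /boolp.choice[p pP] : forall i, exists r, (i < 6)%N ->
   [/\ r != 0, dot r (s ((i + 5) %% 6)%N) = 0, dot r (s i) = 0 & dot r (D' (i %% 3)%N) = 0].
  move=> i; have [i6|] := boolP (i < 6)%N; last by exists 0.
  by have [r rP] := det3_eq0_orth (D'lines i i6); exists r.
have data : hex_data s D' p.
  split; last by exists q.
    move=> i i6; have [a b c d] := pP i i6; split=> //.
    have [_ + _ _] := pP (i.+1 %% 6)%N (@ltn_pmod i.+1 6 isT).
    by rewrite modnDml addSnnS modnDr (modn_small i6).
  by move=> i /D'P[].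
have : inVM pascal (hexagon s D').
  case: (boolp.pselect (exists2 k, (k < 6)%N & cross (p k) (p (k.+1 %% 6)%N) != 0)).
    by case=> k k6; exact: inVM_hex data k6.
  move=> none; exfalso.
  have par k : (k < 6)%N -> cross (p 0%N) (p k) = 0.
    elim: k => [|k IHk] k6; first exact: crossvv.
    have [pk _ _ _] := pP k (ltnW k6).
    apply: (parallel_trans pk); first by rewrite crossC IHk ?oppr0 // ltnW.
    apply/eqP; apply: contraPT none => h; apply; exists k; first exact: ltnW.
    by rewrite modn_small.
  have [p00 _ _ _] := pP 0%N isT; case/eqP: p00; apply: span => j.
  have scale k : (k < 6)%N -> exists2 c, c != 0 & p 0%N = c *: p k.
    move=> k6; have [pk _ _ _] := pP k k6; have [p00 _ _ _] := pP 0%N isT.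
    by apply: parallel_scale => //; rewrite crossC par ?oppr0.
  have ps k : (k < 6)%N -> dot (p 0%N) (s k) = 0.
    move=> k6; have [c _ ->] := scale k k6; have [_ _ h _] := pP k k6.
    by rewrite dotZl h mulr0.
  have pD k : (k < 3)%N -> dot (p 0%N) (D k) = 0.
    move=> k3; have [->|Dk] := eqVneq (D k) 0; first exact: dot0r.
    have k6 : (k < 6)%N by exact: leq_trans k3 _.
    have [c _ ->] := scale k k6; have [_ _ _] := pP k k6.
    by rewrite modn_small // D'E // dotZl => ->; rewrite mulr0.
  rewrite col_hexagon; case: j => [[|[|[|[|[|[|[|[|[|//]]]]]]]]] lt_j] /=;
    by [exact: ps|exact: pD].
move/inVM_scale; apply; apply: (hexagon_colP (R := fun v V => exists c, v = c *: V)) => i i_n.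
  by exists 1; rewrite scale1r.
have [->|Di] := eqVneq (D i) 0; first by exists 0; rewrite scale0r.
by exists 1; rewrite scale1r D'E.
Qed.

End Fill.

(** * Lifting planar configurations *)

Section Lift.
Variable K : numClosedFieldType.
Implicit Types (T : nat -> bool) (x y z : 'rV[K]_9) (g : 'M[K]_(3, 9)) (a b c : 'I_9).

Definition lift_config (P : comNzRingType) (x y z : 'rV[P]_9) : 'M[P]_(3, 9) :=
  \matrix_(i, j) vec (x 0 j) (y 0 j) (z 0 j) i 0.

Lemma col_lift_config (P : comNzRingType) (x y z : 'rV[P]_9) j :
  col j (lift_config x y z) = vec (x 0 j) (y 0 j) (z 0 j).
Proof. by apply/colP => i; rewrite mxE mxE. Qed.

Lemma map_lift_config (P Q : comNzRingType) (f : {rmorphism P -> Q}) (x y z : 'rV[P]_9) :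
  map_mx f (lift_config x y z) = lift_config (map_mx f x) (map_mx f y) (map_mx f z).
Proof.
apply/matrixP => i j; rewrite !mxE.
by case: i => [[|[|[|//]]]] i3.
Qed.

Definition lift_form x y a b c : 'cV[K]_9 :=
  (x 0 b * y 0 c - x 0 c * y 0 b) *: delta_mx a 0
  + (x 0 c * y 0 a - x 0 a * y 0 c) *: delta_mx b 0
  + (x 0 a * y 0 b - x 0 b * y 0 a) *: delta_mx c 0.

Lemma lift_formE x y z a b c : (z *m lift_form x y a b c) 0 0 =
  det3 (col a (lift_config x y z)) (col b (lift_config x y z)) (col c (lift_config x y z)).
Proof.
rewrite !col_lift_config det3E /dot /cross !vecE.
by rewrite !mulmxDr -!scalemxAr -!colE !mxE; ring.
Qed.

(** The singular matrix with columns [u], [v], [0] forgets the third coordinate. *)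
Lemma inVM_lift g u v x y z : (forall j, col j g = x 0 j *: u + y 0 j *: v) ->
  inVM pascal (lift_config x y z) -> inVM pascal g.
Proof.
move=> gE /(inVM_linear (\matrix_(i < 3, j < 3) [:: u i 0; v i 0; 0]`_j) (const_mx 1)).
congr (inVM pascal _); apply/matrixP => i j; rewrite diag_const_mx mulmx1.
have /colP/(_ i) := gE j; rewrite !mxE => ->.
by rewrite !big_ord_recl big_ord0 !mxE /=; ring.
Qed.

Lemma lift_config_span x y z : row_free (col_mx x y) -> ~~ (z <= col_mx x y)%MS ->
  forall q, (forall j, dot q (col j (lift_config x y z)) = 0) -> q = 0.
Proof.
move=> xy_free zxy q q0.
have rel : q o0 0 *: x + q o1 0 *: y + q o2 0 *: z = 0.
  apply/rowP => j; have := q0 j; rewrite col_lift_config /dot !vecE !mxE.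
  by rewrite (mulrC (q o0 0)) => <-; ring.
have q2 : q o2 0 = 0.
  apply/eqP; apply: contraNT zxy => q2.
  have -> : z = row_mx (- (q o0 0 / q o2 0))%:M (- (q o1 0 / q o2 0))%:M *m col_mx x y.
    rewrite mul_row_col !mul_scalar_mx; apply: (scalerI q2).
    rewrite scalerDr !scalerA; apply/eqP; rewrite -subr_eq0 -rel; apply/eqP/rowP => j.
    by rewrite !mxE; field.
  exact: submxMl.
have : row_mx (q o0 0)%:M (q o1 0)%:M *m col_mx x y = 0.
  by rewrite mul_row_col !mul_scalar_mx -rel q2 scale0r addr0.
rewrite -(mul0mx _ (col_mx x y)) => /(row_free_inj xy_free)/rowP qq.
apply: cV3P; rewrite ?q2 !mxE //.
  by have := qq (lshift 1 0); rewrite row_mxEl !mxE eqxx mulr1n.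
by have := qq (rshift 1 0); rewrite row_mxEr !mxE eqxx mulr1n.
Qed.

Lemma exists_row_outside m n (A : 'M[K]_(m, 9)) (B : 'M[K]_(n, 9)) :
  (\rank B < \rank A)%N -> exists2 z : 'rV_9, (z <= A)%MS & ~~ (z <= B)%MS.
Proof.
move=> rBA; case: (boolp.pselect (exists i, ~~ (row i A <= B)%MS)) => [[i iB]|none].
  by exists (row i A) => //; exact: row_sub.
suff AB : (A <= B)%MS by have := mxrankS AB; rewrite leqNgt rBA.
by apply/row_subP => i; apply: contraT => iB; case: none; exists i.
Qed.

(** [T] marks the diagonals replaced by joins of opposite corners. For each [T], [meet_det] is the
    value of a polynomial obtained from the bracket of the diagonals by Grassmann-Cayley
    substitutions. *)
Definition partial_meet (P : comNzRingType) (T : nat -> bool) (g : 'M[P]_(3, 9)) i :=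
  if T i then opposite_meet (hexagon_sides g) i else hexagon_diagonals g i.

Definition meet_det (P : comNzRingType) T (g : 'M[P]_(3, 9)) :=
  det3 (partial_meet T g 0) (partial_meet T g 1) (partial_meet T g 2).

Lemma map_meet_det (P Q : comNzRingType) (f : {rmorphism P -> Q}) T (g : 'M[P]_(3, 9)) :
  f (meet_det T g) = meet_det T (map_mx f g).
Proof.
rewrite /meet_det map_det3; congr det3; rewrite /partial_meet; case: ifP => _;
  by rewrite /opposite_meet /hexagon_sides /hexagon_diagonals ?map_cross !map_col.
Qed.

Definition stretch (t : K) (u : 'cV[K]_3) := vec (u o0 0) (u o1 0) (t * u o2 0).

(** Scaling the third coordinate by [t] stretches a double cross product and multiplies it by the
    determinant [t] of the stretching; the outer determinant contributes one more [t]. *)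
Lemma meet_det_stretch T x y z t : meet_det T (lift_config x y (t *: z))
  = t ^+ (T 0%N + T 1%N + T 2%N).+1 * meet_det T (lift_config x y z).
Proof.
have colE j : col j (lift_config x y (t *: z)) = stretch t (col j (lift_config x y z)).
  by rewrite !col_lift_config /stretch !vecE mxE.
have meetE i : partial_meet T (lift_config x y (t *: z)) i
    = t ^+ T i *: stretch t (partial_meet T (lift_config x y z) i).
  rewrite /partial_meet /opposite_meet /hexagon_sides /hexagon_diagonals !colE.
  case: (T i); last by rewrite scale1r.
  by rewrite expr1; apply: cV3P; rewrite /cross /stretch ?(vecE, mxE) /=; ring.
have det_stretch u v w : det3 (stretch t u) (stretch t v) (stretch t w) = t * det3 u v w.
  by rewrite /stretch; vec_ring.
rewrite /meet_det !meetE det3_scale det_stretch exprS !exprD; ring.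
Qed.

(* [meet_det] is homogeneous of positive degree in the third coordinate. *)
Lemma exists_meet_zero T x y (z0 z1 : 'rV[K]_9) :
  meet_det T (lift_config x y z0) = 0 \/
  exists r, meet_det T (lift_config x y (z1 + r *: z0)) = 0.
Proof.
pose F z := meet_det T (lift_config x y z).
have Fpoly (u v : 'rV[K]_9) : exists F' : {poly K}, forall r, F (u + r *: v) = F'.[r].
  exists (meet_det T (lift_config (map_mx polyC x) (map_mx polyC y) (lerp u (u + v)))) => r.
  rewrite -[RHS]/(horner_eval r _) map_meet_det map_lift_config lerpE addrAC subrr add0r.
  suff cE (w : 'rV[K]_9) : map_mx (horner_eval r) (map_mx polyC w) = w by rewrite !cE.
  by apply/rowP => j; rewrite !mxE /horner_eval hornerC.
have [F' F'E] := Fpoly z1 z0.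
have [/size1_polyC F'c|] := leqP (size F') 1; last first.
  by move=> F'1; right; have /closed_rootP[r /rootP rF] : size F' != 1%N;
    [rewrite neq_ltn F'1 orbT|exists r; rewrite -/(F _) F'E].
(* Here [F (z1 + r z0)] is a constant [c], so homogeneity gives [F (z0 + r z1) = c r^d] for nonzero
   [r]. As an identity of polynomials it also holds at 0, where [d > 0] makes it vanish; the factor
   ['X] below covers the excluded parameter. *)
left; have [H HE] := Fpoly z0 z1.
pose d := (T 0%N + T 1%N + T 2%N).+1; pose c := F'`_0.
have : ('X * (H - c *: 'X^d) = 0).
  apply: poly_eq0_horner => r; rewrite !hornerE; have [->|r0] := eqVneq r 0.
    by rewrite mul0r.
  rewrite -HE; have -> : z0 + r *: z1 = r *: (z1 + r^-1 *: z0).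
    by rewrite scalerDr scalerA divff // scale1r addrC.
  by rewrite /F meet_det_stretch -/(F _) F'E F'c hornerC mulrC [X in X - _]mulrC subrr mul0r.
move/eqP; rewrite mulf_eq0 polyX_eq0 /= subr_eq0 => /eqP HX.
have := HE 0; rewrite scale0r addr0 /F => ->.
by rewrite HX !hornerE expr0n /= mulr0.
Qed.

Lemma zero_col_rank m (A : 'M[K]_(m, 6)) k : col k A = 0 -> (\rank A <= 5)%N.
Proof.
by rewrite colE => /mulmx0_rank_max; rewrite mxrank_delta addn1 ltnS.
Qed.

Definition side_line_form x y i :=
  lift_form x y (side_idx ((i + 5) %% 6)) (side_idx i) (diagonal_idx (i %% 3)).

(* A vanishing diagonal [i] replaces two line conditions by the single equation
   [z = 0] at that point; the column [i + 3] left empty makes the rank drop. *)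
Definition lift_equations (T : nat -> bool) x y : 'M[K]_(9, 6) :=
  \matrix_(j, i) (if T (i %% 3)%N then
      if (i < 3)%N then (j == diagonal_idx i)%:R else 0
    else side_line_form x y i j 0).

Lemma lift_equationsP T x y z : z *m lift_equations T x y = 0 ->
  (forall i, (i < 6)%N -> ~~ T (i %% 3)%N -> (z *m side_line_form x y i) 0 0 = 0) /\
  (forall i, (i < 3)%N -> T i -> z 0 (diagonal_idx i) = 0).
Proof.
move=> zA; split=> i i_n Ti.
  have /rowP/(_ (Ordinal i_n)) := zA; rewrite !mxE => zAi; rewrite -[RHS]zAi.
  by apply: eq_bigr => j _; rewrite [in RHS]mxE /= (negPf Ti).
have i6 : (i < 6)%N by exact: leq_trans i_n _.
have /rowP/(_ (Ordinal i6)) := zA; rewrite !mxE => zAi; rewrite -[RHS]zAi.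
rewrite (bigD1 (diagonal_idx i)) //= big1 ?addr0 => [|j ji].
  by rewrite mxE /= modn_small // Ti i_n eqxx mulr1.
by rewrite mxE /= modn_small // Ti i_n (negPf ji) mulr0.
Qed.

(** At most five independent equations on nine unknowns leave a kernel of dimension at least 4. It
    contains [z0] and [z1] independent modulo the span of [x] and [y], and [exists_meet_zero] finds
    a zero among [z0] and the [z1 + r z0]. *)
Lemma exists_lift_zero T x y : (exists2 k, (k < 3)%N & T k) ->
  exists z, [/\ ~~ (z <= col_mx x y)%MS,
    forall i, (i < 6)%N -> ~~ T (i %% 3)%N -> (z *m side_line_form x y i) 0 0 = 0,
    forall i, (i < 3)%N -> T i -> z 0 (diagonal_idx i) = 0
    & meet_det T (lift_config x y z) = 0].
Proof.
move=> [k k3 Tk]; pose A := lift_equations T x y.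
have k6 : (k + 3 < 6)%N by rewrite (@ltn_add2r 3 k 3).
have rA : (\rank A <= 5)%N.
  apply: (@zero_col_rank _ _ (Ordinal k6)); apply/colP => j; rewrite !mxE /=.
  by rewrite modnDr modn_small // Tk ltnNge leq_addl.
have rN : (4 <= \rank (kermx A))%N.
  by rewrite mxrank_ker; apply: (@leq_trans (9 - 5)%N) => //; exact: leq_sub2l.
have [z0 z0A z0xy] : exists2 z0 : 'rV_9, (z0 <= kermx A)%MS & ~~ (z0 <= col_mx x y)%MS.
  apply: exists_row_outside; apply: leq_ltn_trans (rank_leq_row _) _.
  exact: leq_trans rN.
have [z1 z1A z1xy] : exists2 z1 : 'rV_9, (z1 <= kermx A)%MS & ~~ (z1 <= col_mx (col_mx x y) z0)%MS.
  by apply: exists_row_outside; apply: leq_ltn_trans (rank_leq_row _) _.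
have kerP z : (z <= kermx A)%MS -> meet_det T (lift_config x y z) = 0 ->
    ~~ (z <= col_mx x y)%MS -> exists z, [/\ ~~ (z <= col_mx x y)%MS,
    forall i, (i < 6)%N -> ~~ T (i %% 3)%N -> (z *m side_line_form x y i) 0 0 = 0,
    forall i, (i < 3)%N -> T i -> z 0 (diagonal_idx i) = 0
    & meet_det T (lift_config x y z) = 0].
  by move=> /sub_kermxP/lift_equationsP[h1 h2] h3 h4; exists z.
have [F0|[r Fr]] := exists_meet_zero T x y z0 z1; first exact: (kerP z0).
apply: (kerP _ _ Fr); first by rewrite addmx_sub // scalemx_sub.
apply: contra z1xy => zr; rewrite -[z1](addrK (r *: z0)).
rewrite -addsmxE addmx_sub_adds // -scaleNr scalemx_sub //.
Qed.

Lemma rank2_inVM g u v x y : (forall j, col j g = x 0 j *: u + y 0 j *: v) ->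
  cross u v != 0 -> row_free (col_mx x y) ->
  (forall q, exists N : 'M[K]_9, (3 <= \rank N)%N /\
     forall z : 'rV[K]_9, (z <= N)%MS -> forall a b c : 'I_9, uniq [:: a; b; c] -> aligned a b c ->
       z 0 a * det3 (col b g) (col c g) q + z 0 b * det3 (col c g) (col a g) q
       + z 0 c * det3 (col a g) (col b g) q = 0) ->
  inVM pascal g.
Proof.
move=> gE uv xy lift.
pose T i := hexagon_diagonals g i == 0.
have T0 i : T i -> x 0 (diagonal_idx i) = 0 /\ y 0 (diagonal_idx i) = 0.
  rewrite /T /hexagon_diagonals gE => /eqP d0; split; apply/eqP.
    apply: contraNT uv => xi.
    have : cross (x 0 (diagonal_idx i) *: u + y 0 (diagonal_idx i) *: v) v = 0.
      by rewrite d0 cross0v.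
    by rewrite crossDl !crossZl crossvv scaler0 addr0 => /eqP; rewrite scaler_eq0 (negPf xi).
  apply: contraNT uv => yi.
  have : cross u (x 0 (diagonal_idx i) *: u + y 0 (diagonal_idx i) *: v) = 0.
    by rewrite d0 crossv0.
  by rewrite crossDr !crossZr crossvv scaler0 add0r => /eqP; rewrite scaler_eq0 (negPf yi).
suff [z [zxy lines Tz meet0]] : exists z, [/\ ~~ (z <= col_mx x y)%MS,
    forall i, (i < 6)%N -> ~~ T (i %% 3)%N -> (z *m side_line_form x y i) 0 0 = 0,
    forall i, (i < 3)%N -> T i -> z 0 (diagonal_idx i) = 0
    & meet_det T (lift_config x y z) = 0].
  apply: (inVM_lift gE (z := z)).
  (* The lift makes no vanishing diagonal nonzero, so [T] is also the zero test in [inVM_rank3]. *)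
  have Dz i : (i < 3)%N -> (hexagon_diagonals (lift_config x y z) i == 0) = T i.
    move=> i3; rewrite /hexagon_diagonals col_lift_config; apply/idP/idP => [/eqP d0|Ti].
      have := d0; move/colP => h; have := h o0; have := h o1; rewrite !vecE !mxE => yi xi.
      by rewrite /T /hexagon_diagonals gE xi yi !scale0r addr0.
    have [xi yi] := T0 i Ti; apply/eqP/cV3P; rewrite !vecE mxE //; exact: Tz.
  rewrite -(hexagonE (lift_config x y z)); apply: inVM_rank3.
  - move=> i i6; have i3 : (i %% 3 < 3)%N by rewrite ltn_mod.
    have [Ti|Ti] := boolP (T (i %% 3)%N).
      by have := Dz _ i3; rewrite Ti => /eqP ->; vec_ring.
    by have := lines i i6 Ti; rewrite lift_formE.
  - by move: meet0; rewrite /meet_det /partial_meet /= !Dz.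
  - by rewrite hexagonE; exact: lift_config_span.
case: (boolp.pselect (exists2 k, (k < 3)%N & T k)) => [|none]; first exact: exists_lift_zero.
(* For this [q] the bracket of two columns with [q] equals the minor of their plane coordinates, so
   [lift] states the collinearities of the lifted configuration. *)
have [q uvq] := vec_dual uv.
have [N [N3 NP]] := lift q.
have [z zN zxy] : exists2 z : 'rV_9, (z <= N)%MS & ~~ (z <= col_mx x y)%MS.
  by apply: exists_row_outside; apply: leq_ltn_trans (rank_leq_row _) _.
have noT i : (i < 3)%N -> T i = false by move=> i3; apply/negP => Ti; apply: none; exists i.
have line0 (a b c : 'I_9) : uniq [:: a; b; c] -> aligned a b c ->
    (z *m lift_form x y a b c) 0 0 = 0.
  move=> uabc aabc; rewrite -(NP z zN a b c uabc aabc).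
  have det_q i j : det3 (col i g) (col j g) q = x 0 i * y 0 j - x 0 j * y 0 i.
    rewrite !gE -[RHS]mulr1 -uvq -(det3E u v q).
    by vec_ring.
  rewrite !det_q !mulmxDr -!scalemxAr -!colE !mxE; ring.
exists z; split=> //.
- move=> i i6 _; apply: line0; move: i i6 => [|[|[|[|[|[|//]]]]]] _;
    by rewrite /side_idx /diagonal_idx /= ?inE -?val_eqE /= ?inordK.
- by move=> i i3; rewrite noT.
rewrite /meet_det /partial_meet !noT // /hexagon_diagonals -lift_formE.
by apply: line0; rewrite /diagonal_idx /= ?inE -?val_eqE /= ?inordK.
Qed.

(** The first coordinates of the realization are all nonzero, so the rank one map that sends a
    vector to its first coordinate times [u], followed by a rescaling of the columns, reaches every
    [u *m c]. *)
Lemma rank1_inVM (u : 'cV[K]_3) (c : 'rV[K]_9) : inVM pascal (u *m c).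
Proof.
have g0 : inVM pascal (pascal_realization K) by apply/Gamma_inVM/pascal_realizationP.
have first j : pascal_realization K o0 j != 0.
  rewrite mxE; case: j => [[|[|[|[|[|[|[|[|[|//]]]]]]]]] lt_j];
  by rewrite /= ?mulrNz ?oppr_eq0 intr_eq0.
have := inVM_linear (u *m delta_mx 0 o0) (\row_j (c 0 j / pascal_realization K o0 j)) g0.
congr (inVM pascal _); rewrite -[_ *m _ *m pascal_realization K]mulmxA -rowE.
apply/matrixP => i j; rewrite mul_mx_diag [LHS]mxE [in LHS]mxE [RHS]mxE !big_ord1.
rewrite [row _ _ _ _]mxE [(\row__ _) _ _]mxE -mulrA; congr (_ * _).
by rewrite mulrC divfK.
Qed.

End Lift.

(** * The three ideals *)

Section Minors.
Variable F : fieldType.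

Lemma mxrank_mxsub m n m' n' (f : 'I_m' -> 'I_m) (g : 'I_n' -> 'I_n) (A : 'M[F]_(m, n)) :
  (\rank (mxsub f g A) <= \rank A)%N.
Proof.
have row_le p q q' (h : 'I_q' -> 'I_q) (B : 'M[F]_(q, p)) : (\rank (rowsub h B) <= \rank B)%N.
  exact/mxrankS/rowsub_sub.
rewrite -[mxsub f g A](_ : rowsub f (colsub g A) = _); last by apply/matrixP => i j; rewrite !mxE.
apply: leq_trans (row_le _ _ _ f _) _; rewrite -mxrank_tr -(mxrank_tr A).
suff -> : (colsub g A)^T = rowsub g A^T by exact: row_le.
by apply/matrixP => i j; rewrite !mxE.
Qed.

(** A rank of at least [k] yields [k] independent rows, and then [k] columns on which they form an
    invertible matrix. *)
Lemma mxrank_lt_minors m n k (A : 'M[F]_(m, n)) :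
  (forall (f : 'I_k -> 'I_m) (g : 'I_k -> 'I_n), injective f -> injective g ->
     \det (mxsub f g A) = 0) -> (\rank A < k)%N.
Proof.
move=> minors; rewrite ltnNge; apply/negP => kA.
pose h := widen_ord kA; pose B := rowsub (maxrankfun A) A.
have h_inj : injective h by move=> i j /(congr1 val) /= ij; apply: val_inj.
have hB_free : row_free (rowsub h B).
  apply: inj_row_free => w; rewrite rowsubE mulmxA -(mul0mx _ B).
  move/(row_free_inj (maxrowsub_free A))/rowP => w0; apply/rowP => i.
  have := w0 (h i); rewrite !mxE (bigD1 i) //= big1 => [|j ji].
    by rewrite !mxE eqxx mulr1 addr0.
  by rewrite !mxE (inj_eq h_inj) (negPf ji) mulr0.
have hB_full : row_full (rowsub h B)^T by rewrite /row_full mxrank_tr.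
have := fullrowsub_unit hB_full; rewrite -unitmx_tr unitmxE unitfE => /eqP; apply.
rewrite -(minors (maxrankfun A \o h) (fullrankfun hB_full)).
- by congr (\det _); apply/matrixP => i j; rewrite !mxE.
- by apply: inj_comp => //; exact: maxrankfun_inj.
- exact: fullrankfun_inj.
Qed.

End Minors.

Lemma uniq_card3 (T : finType) (i j k : T) : #|[set i; j; k]| = 3%N -> uniq [:: i; j; k].
Proof.
move=> c3; apply/card_uniqP; rewrite /= -c3; apply: eq_card => x.
by rewrite !inE orbA.
Qed.

Section Generators.
Variable K : numClosedFieldType.
Implicit Types (g h : 'M[K]_(3, 9)) (M : matroid 'I_9).
Local Notation Pol := {mpoly K[3 * 9]}.

Definition vanishes_at g (I : Pol -> Prop) : Prop := forall f, I f -> evalX f g = 0.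

Lemma vanishes_ideal_gen g (F : Pol -> Prop) : vanishes_at g F -> vanishes_at g (ideal_gen F).
Proof.
move=> Fg _ [k [a [f [Ff ->]]]]; rewrite /evalX raddf_sum big1 // => i _ /=.
by rewrite mevalM [X in _ * X]Fg ?mulr0.
Qed.

Lemma is_ideal_gen (F : Pol -> Prop) : is_ideal (ideal_gen F).
Proof.
split.
- by exists 0%N, (fun=> 0), (fun=> 0); split=> [[]//|]; rewrite big_ord0.
- move=> _ _ [k [a [f [Ff ->]]]] [l [b [e [Fe ->]]]].
  exists (k + l)%N, (fun i => match split i with inl j => a j | inr j => b j end).
  exists (fun i => match split i with inl j => f j | inr j => e j end); split.
    by move=> i; case: split.
  rewrite big_split_ord /=; congr (_ + _); apply: eq_bigr => i _.
    by rewrite (unsplitK (inl i)).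
  by rewrite (unsplitK (inr i)).
- move=> c _ [k [a [f [Ff ->]]]]; exists k, (fun i => c * a i), f; split=> //.
  by rewrite mulr_sumr; apply: eq_bigr => i _; rewrite mulrA.
Qed.

Lemma gen_sub_ideal (F : Pol -> Prop) f : F f -> ideal_gen F f.
Proof.
by move=> Ff; exists 1%N, (fun=> 1), (fun=> f); rewrite big_ord1 mul1r.
Qed.

Lemma is_ideal_add (I J : Pol -> Prop) : is_ideal I -> is_ideal J -> is_ideal (ideal_add I J).
Proof.
move=> [I0 ID IM] [J0 JD JM]; split.
- by exists 0, 0; rewrite addr0.
- move=> _ _ [a [b [Ia Jb ->]]] [c [d [Ic Jd ->]]].
  by exists (a + c), (b + d); split; [exact: ID|exact: JD|rewrite addrACA].
- move=> c _ [a [b [Ia Jb ->]]].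
  by exists (c * a), (c * b); split; [exact: IM|exact: JM|rewrite mulrDr].
Qed.

Lemma ideal_add_left (I J : Pol -> Prop) f : is_ideal J -> I f -> ideal_add I J f.
Proof. by case=> J0 _ _ If; exists f, 0; rewrite addr0. Qed.

Lemma ideal_add_right (I J : Pol -> Prop) f : is_ideal I -> J f -> ideal_add I J f.
Proof. by case=> I0 _ _ Jf; exists 0, f; rewrite add0r. Qed.

Lemma GC_gens_mono M s t : (s <= t)%N -> forall f : Pol, GC_gens M s f -> GC_gens M t f.
Proof.
move=> /subnKC <- f Gf; elim: (t - s)%N => [|n IHn]; first by rewrite addn0.
by rewrite addnS; left.
Qed.

Lemma is_ideal_GC M : is_ideal (GC_ideal K M).
Proof.
have gen t := is_ideal_gen (@GC_gens K 9 M t).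
split.
- by exists 0%N => t _; case: (gen t).
- move=> f e [s fs] [s' es']; exists (maxn s s') => t; rewrite geq_max => /andP[st s't].
  by case: (gen t) => _ D _; apply: D; [exact: fs|exact: es'].
- by move=> c f [s fs]; exists s => t st; case: (gen t) => _ _; apply; exact: fs.
Qed.

Lemma GC_gens_ideal M s f : GC_gens M s f -> GC_ideal K M f.
Proof. by move=> fs; exists s => t st; apply/gen_sub_ideal/(GC_gens_mono st). Qed.

Lemma meval_bracket g i j k : evalX (bracket K i j k) g = det3 (col i g) (col j g) (col k g).
Proof. by rewrite /evalX /bracket map_det3 !map_col evalX_X. Qed.

Lemma meval_bracketq g i j q : evalX (bracketq i j q) g = det3 (col i g) (col j g) q.
Proof.
rewrite /evalX /bracketq map_det3 !map_col evalX_X; congr det3.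
by apply/colP => r; rewrite !mxE /= mevalC.
Qed.

Lemma meval_meet g p1 p2 p3 p4 :
  map_mx (meval (mxvec g ord0))
    (bracket K p1 p2 p3 *: col p4 (X K 9) - bracket K p1 p2 p4 *: col p3 (X K 9))
  = det3 (col p1 g) (col p2 g) (col p3 g) *: col p4 g
    - det3 (col p1 g) (col p2 g) (col p4 g) *: col p3 g.
Proof.
by rewrite map_mxB !map_mxZ; congr (_ *: _ - _ *: _);
  [exact: meval_bracket|rewrite map_col evalX_X|exact: meval_bracket|rewrite map_col evalX_X].
Qed.

Definition set_col g x (v : 'cV[K]_3) : 'M[K]_(3, 9) :=
  \matrix_(i, j) if j == x then v i 0 else g i j.

Lemma meval_subst_col g x v f :
  evalX (subst_col x v f) g = evalX f (set_col g x (map_mx (meval (mxvec g ord0)) v)).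
Proof.
rewrite /subst_col evalX_comp; congr evalX; apply/matrixP => i j; rewrite !mxE.
by case: eqP => _; rewrite ?mxE // mevalXU mxvecE.
Qed.

Lemma col_set_col g x v j : col j (set_col g x v) = if j == x then v else col j g.
Proof. by apply/colP => i; rewrite !mxE; case: eqP => _; rewrite ?mxE. Qed.

End Generators.

(** * Circuit and Grassmann-Cayley generators at realizations *)

Section OnGamma.
Variable K : numClosedFieldType.
Implicit Types (g h : 'M[K]_(3, 9)).
Local Notation Pol := {mpoly K[3 * 9]}.

Lemma circuit_brackets_Gamma g : Gamma pascal g -> vanishes_at g (circuit_brackets pascal).
Proof.
move=> /GammaP Gg _ [i [j [k [c3 cC ->]]]]; have u := uniq_card3 c3.
apply/eqP; rewrite meval_bracket Gg //.
by rewrite -mem_pascal_lines3 // -pascal_circuit3.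
Qed.

Lemma pascal_line_orth g l : Gamma pascal g -> l \in pascal_lines ->
  exists2 p, p != 0 & forall x, x \in l -> dot p (col x g) = 0.
Proof.
move=> /GammaP Gg lP; have [i [j [k [u lE _]]]] := enum3 (card_pascal_line lP).
have [|p [p0 pi pj pk]] := @det3_eq0_orth _ (col i g) (col j g) (col k g).
  by apply/eqP; rewrite Gg // -mem_pascal_lines3 // -lE.
by exists p => // x; rewrite lE !inE => /orP[/orP[]|] /eqP ->.
Qed.

Lemma pascal_lines_meet_unaligned l1 l2 x : l1 \in pascal_lines -> l2 \in pascal_lines ->
  l1 != l2 -> x \in l1 -> x \in l2 ->
  exists y z, [/\ y \in l1, z \in l2, uniq [:: x; y; z] & ~~ aligned x y z].
Proof.
move=> l1P l2P l12 x1 x2.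
have other l : l \in pascal_lines -> x \in l -> exists2 y, y \in l & x != y.
  move=> lP xl; have : (0 < #|l :\ x|)%N.
    by have := card_pascal_line lP; rewrite (cardsD1 x) xl add1n => -[->].
  by move=> /card_gt0P[y /setD1P[yx yl]]; exists y; rewrite // eq_sym.
have [y y1 xy] := other _ l1P x1; have [z z2 xz] := other _ l2P x2.
have yz : y != z.
  apply: contraNneq l12 => yz; apply/eqP; apply: (pascal_lines_inj l1P l2P xy) => //.
  by rewrite yz.
have u : uniq [:: x; y; z] by rewrite /= !inE negb_or xy xz yz.
exists y, z; split=> //; rewrite -mem_pascal_lines3 //; apply: contra l12 => lP.
have [xl yl zl] : [/\ x \in [set x; y; z], y \in [set x; y; z] & z \in [set x; y; z]].
  by rewrite !inE !eqxx !orbT.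
by rewrite (pascal_lines_inj l1P lP xy) // (pascal_lines_inj l2P lP xz).
Qed.

(** The left side is orthogonal to the normals of both lines, hence a multiple of their meet, which
    is the column [x]. The factor [c] may be zero, for instance when [p1 = p2]. *)
Lemma line_meet_parallel g l1 l2 x p1 p2 p3 p4 : Gamma pascal g ->
  l1 \in pascal_lines -> l2 \in pascal_lines -> l1 != l2 -> x \in l1 -> x \in l2 ->
  p1 \in l1 -> p2 \in l1 -> p3 \in l2 -> p4 \in l2 ->
  exists c, det3 (col p1 g) (col p2 g) (col p3 g) *: col p4 g
            - det3 (col p1 g) (col p2 g) (col p4 g) *: col p3 g = c *: col x g.
Proof.
move=> Gg l1P l2P l12 x1 x2 p11 p21 p32 p42.
have [n1 n10 n1l] := pascal_line_orth Gg l1P.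
have [n2 n20 n2l] := pascal_line_orth Gg l2P.
have [y [z [y1 z2 u al]]] := pascal_lines_meet_unaligned l1P l2P l12 x1 x2.
have xyz : det3 (col x g) (col y g) (col z g) != 0 by move/GammaP: Gg => ->.
have n12 : cross n1 n2 != 0.
  apply: contraNneq xyz => /(parallelP n10)[c n2E]; apply/eqP.
  apply: (det3_orth_eq0 n10); [exact: n1l|exact: n1l|].
  have : dot n2 (col z g) = 0 by rewrite n2l.
  have c0 : c != 0 by apply: contraNneq n20 => c0; rewrite n2E c0 scale0r.
  by rewrite n2E dotZl => /eqP; rewrite mulf_eq0 (negPf c0) => /eqP.
have [a xE] : exists a, col x g = a *: cross n1 n2.
  by apply: (orth2_cross n12); rewrite dotC; [exact: n1l|exact: n2l].
have a0 : a != 0.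
  apply: contraNneq (cross_neq0l (det3_neq0_cross xyz)) => a0.
  by rewrite xE a0 scale0r.
set v := _ - _; have [b ->] : exists b, v = b *: cross n1 n2.
  apply: orth2_cross => //; last first.
    by rewrite dotC dotDr -scaleNr !dotZr !n2l // !mulr0 addr0.
  have [b bE] : exists b, cross (col p1 g) (col p2 g) = b *: n1.
    apply: parallelP => //; rewrite triple_cross.
    by rewrite !n1l // !scale0r subrr.
  have dE w : det3 (col p1 g) (col p2 g) w = b * dot n1 w by rewrite det3E bE dotZl.
  by rewrite /v !dE dotC dotDr -scaleNr !dotZr; ring.
by exists (b / a); rewrite xE scalerA divfK.
Qed.

(** A substitution replaces the column [x] by a multiple of itself, possibly zero, which leaves
    [Gamma]. Allowing arbitrary rescalings [c] of the columns makes the induction close. *)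
Lemma GC_gens_Gamma g s (c : 'rV[K]_9) : Gamma pascal g ->
  vanishes_at (g *m diag_mx c) (GC_gens pascal s).
Proof.
move=> Gg; have colD (e : 'rV[K]_9) j : col j (g *m diag_mx e) = e 0 j *: col j g.
  by rewrite -[in LHS](mul1mx g) col_lin mul1mx.
elim: s c => [|s IHs] c f /=.
  move=> [i [j [k [c3 cC ->]]]]; rewrite meval_bracket !colD det3_scale -meval_bracket.
  by rewrite (circuit_brackets_Gamma Gg) ?mulr0 //; exists i, j, k.
case=> [/IHs //|[f0 [x [l1 [l2 [p1 [p2 [p3 [p4 [f0s]]]]]]]]]].
case=> [[l1P l2P x1 x2 l12] [[p11 p21 p32 p42] ->]].
rewrite !pascal_line in l1P l2P.
have [a aE] := line_meet_parallel Gg l1P l2P l12 x1 x2 p11 p21 p32 p42.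
rewrite meval_subst_col.
(* The substituted vector is linear in each of the columns [p1], [p2], [p3], [p4], so their four
   scalars come out as factors. *)
pose e : 'rV[K]_9 := \row_j if j == x then c 0 p1 * c 0 p2 * c 0 p3 * c 0 p4 * a else c 0 j.
suff -> : set_col (g *m diag_mx c) x (map_mx (meval (mxvec (g *m diag_mx c) ord0))
    (bracket K p1 p2 p3 *: col p4 (X K 9) - bracket K p1 p2 p4 *: col p3 (X K 9)))
    = g *m diag_mx e by exact: IHs.
suff colE j : col j (set_col (g *m diag_mx c) x (map_mx (meval (mxvec (g *m diag_mx c) ord0))
    (bracket K p1 p2 p3 *: col p4 (X K 9) - bracket K p1 p2 p4 *: col p3 (X K 9))))
    = col j (g *m diag_mx e).
  by apply/matrixP => i j; have /colP/(_ i) := colE j; rewrite ![col _ _ _ _]mxE.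
rewrite col_set_col colD [e _ _]mxE; case: eqP => [->|_]; last by rewrite colD.
rewrite meval_meet !colD !det3_scale.
rewrite -[RHS]scalerA -aE scalerBr !scalerA; congr (_ *: _ - _ *: _); ring.
Qed.

End OnGamma.

(** * Rank and kernel of the liftability matrix *)

Section Lifting.
Variable K : numClosedFieldType.
Implicit Types (g h : 'M[K]_(3, 9)) (q : 'cV[K]_3).
Local Notation Pol := {mpoly K[3 * 9]}.

Definition lift_entry g q (c : 'I_9 * 'I_9 * 'I_9) x : K := evalX (liftability_entry q c x) g.

Lemma lift_row_sum g q c1 c2 c3 (A : {set 'I_9}) (w : 'I_9 -> K) :
  uniq [:: c1; c2; c3] -> [set c1; c2; c3] \subset A ->
  \sum_(x in A) lift_entry g q (c1, c2, c3) x * w x =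
    w c1 * det3 (col c2 g) (col c3 g) q + w c2 * det3 (col c3 g) (col c1 g) q
    + w c3 * det3 (col c1 g) (col c2 g) q.
Proof.
rewrite /= !inE negb_or !andbT => /andP[/andP[c12 c13] c23] cA.
have cin c : c \in [set c1; c2; c3] -> c \in A by move/(subsetP cA).
rewrite (bigD1 c1) ?cin ?inE ?eqxx //= (bigD1 c2) /= ?cin ?inE ?eqxx ?orbT //=; last first.
  by rewrite eq_sym.
rewrite (bigD1 c3) /= ?cin ?inE ?eqxx ?orbT //=; last by rewrite ![c3 == _]eq_sym c13.
rewrite big1 => [|x /andP[/andP[/andP[_ x1] x2] x3]]; last first.
  by rewrite /lift_entry /= (negPf x1) (negPf x2) (negPf x3) /evalX meval0 mul0r.
rewrite /lift_entry /= eqxx ![_ == c1]eq_sym (negPf c12) (negPf c13) eqxx.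
rewrite (eq_sym c3) (negPf c23) eqxx addr0.
transitivity (det3 (col c2 g) (col c3 g) q * w c1
   + (- det3 (col c1 g) (col c3 g) q * w c2 + det3 (col c1 g) (col c2 g) q * w c3)).
  congr (_ * _ + (_ * _ + _ * _)); [exact: meval_bracketq| |exact: meval_bracketq].
  by rewrite /evalX mevalN; congr (- _); exact: meval_bracketq.
by vec_ring.
Qed.

Definition eval_lift_matrix g q (N : matroid 'I_9) :=
  map_mx (meval (mxvec g ord0)) (liftability_matrix q N).

Lemma eval_lift_matrixE g q N i j :
  eval_lift_matrix g q N i j = lift_entry g q (enum_val i) (enum_val j).
Proof. by rewrite !mxE. Qed.

Lemma exists_independent_triple (N : matroid 'I_9) : mrank N = 3%N ->
  exists2 A : {set 'I_9}, indep N A & (3 <= #|A|)%N.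
Proof.
move=> rN; apply: boolp.contrapT => none.
suff : (mrank N <= 2)%N by rewrite rN.
apply/bigmax_leqP => A iA; rewrite leqNgt; apply/negP => A3.
by apply: none; exists A.
Qed.

(** By Cramer's identity a row of the matrix applied to the coordinates of [g] gives the bracket of
    its circuit times [q], which is zero. The three coordinate vectors are independent on a
    restriction of rank three, so the rank is at most [n - 3]. *)
Lemma lifting_minors_Gamma g : Gamma pascal g -> vanishes_at g (lifting_minors pascal).
Proof.
move=> Gg _ [S [q [f [e [rN f_inj e_inj ->]]]]].
set N := Defs.restrict pascal S in f e rN f_inj e_inj *.
set n := #|ground N| in f e f_inj e_inj *.
have groundN : ground N = S by rewrite /= setTI.
have [A iA A3] : exists2 A, indep N A & (3 <= #|A|)%N.
  by apply: exists_independent_triple; rewrite rN pascal_rank.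
have [/andP[A3' Al] AS] : pascal_indep A /\ A \subset S by case/andP: iA.
have cA : #|A| = 3%N by apply/eqP; rewrite eqn_leq A3'.
have [i [j [k [u AE _]]]] := enum3 cA.
have nal : ~~ aligned i j k by rewrite -mem_pascal_lines3 // -AE.
have n3 : (3 <= n)%N by rewrite /n groundN (leq_trans A3) ?subset_leq_card.
pose L := eval_lift_matrix g q N.
pose Z : 'M[K]_(n, 3) := \matrix_(x, r) g r (enum_val x).
have LZ : L *m Z = 0.
  apply/matrixP => c r; rewrite !mxE.
  under eq_bigr => x _ do rewrite eval_lift_matrixE mxE.
  rewrite -(big_enum_val (fun x => lift_entry g q (enum_val c) x * g r x)) /=.
  have := enum_valP c; rewrite inE; case: (enum_val c) => [[c1 c2] c3] /= /and3P[c12 c23 cC].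
  have uc : uniq [:: c1; c2; c3].
    by rewrite /= !inE negb_or -!val_eqE /= !neq_ltn c12 c23 (ltn_trans c12 c23).
  have dC : dependent N [set c1; c2; c3] by case/minsetp: cC.
  rewrite lift_row_sum //; last by case/andP: dC.
  have al : aligned c1 c2 c3.
    rewrite -mem_pascal_lines3 // -(pascal_dependent3 (card_set3 uc)).
    case/andP: dC => dS; rewrite /dependent subsetT /= => /nandP[//|].
    by rewrite /= setTI in dS; rewrite dS.
  move/GammaP: Gg => /(_ _ _ _ uc); rewrite al => /eqP d0.
  have -> : g r c1 * det3 (col c2 g) (col c3 g) q + g r c2 * det3 (col c3 g) (col c1 g) q
     + g r c3 * det3 (col c1 g) (col c2 g) q = det3 (col c1 g) (col c2 g) (col c3 g) * q r 0.
    have /colP/(_ r) := cramer (col c1 g) (col c2 g) (col c3 g) q.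
    by rewrite !mxE => <-; ring.
  by rewrite d0 mul0r.
have rZ : \rank Z = 3%N.
  rewrite -mxrank_tr; apply/eqP; rewrite -/(row_free Z^T).
  apply: inj_row_free => w wZ; apply/eqP; apply: contraNT nal => w0.
  have wS x : x \in S -> dot w^T (col x g) = 0.
    move=> xS; have xN : x \in ground N by rewrite groundN.
    have /rowP/(_ (enum_rank_in xN x)) := wZ; rewrite !mxE => wx; rewrite -[RHS]wx.
    rewrite !big_ord_recl big_ord0 addr0 addrA /dot !mxE.
    by rewrite (enum_rankK_in xN xN).
  move/GammaP: Gg => <- //; apply/eqP; apply: (@det3_orth_eq0 _ w^T); rewrite ?trmx_eq0 //;
    by apply: wS; apply: (subsetP AS); rewrite AE !inE eqxx ?orbT.
have rL : (\rank L + 3 <= n)%N by have := mulmx0_rank_max LZ; rewrite rZ.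
rewrite /evalX -[LHS]/(meval _ _) -det_map_mx.
apply/eqP; apply: contraTT rL => d0.
have := mxrank_mxsub f e L; rewrite -ltnNge.
rewrite (_ : mxsub f e L = map_mx (meval (mxvec g ord0)) (mxsub f e (liftability_matrix q N)));
  last by apply/matrixP => a b; rewrite !mxE.
rewrite mxrank_unit ?unitmxE ?unitfE //.
by rewrite leq_subLR add2n addn3 ltnS.
Qed.

(** Applied to the whole matroid, the vanishing of the 7-minors bounds the rank by 6 on 9
    columns. *)
Lemma lifting_kernel g q : vanishes_at g (lifting_minors pascal) ->
  exists N : 'M[K]_9, (3 <= \rank N)%N /\
    forall z : 'rV[K]_9, (z <= N)%MS -> forall a b c : 'I_9, uniq [:: a; b; c] ->
      aligned a b c ->
      z 0 a * det3 (col b g) (col c g) q + z 0 b * det3 (col c g) (col a g) q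
      + z 0 c * det3 (col a g) (col b g) q = 0.
Proof.
move=> minors; pose N := Defs.restrict pascal [set: 'I_9].
have indepN A : indep N A = indep pascal A by rewrite /= subsetT andbT.
have groundN : ground N = setT by rewrite /= setTI.
have rN : mrank N = mrank pascal by apply: eq_bigl => A; rewrite indepN.
have depN A : dependent N A = dependent pascal A.
  by rewrite /dependent groundN subsetT indepN.
pose L : 'M[K]_(#|circuit_triples N|, 9) :=
  \matrix_(i, j) lift_entry g q (enum_val i) j.
have rL : (\rank L < #|ground N| - 2)%N.
  apply: mxrank_lt_minors => f e f_inj e_inj.
  have inN j : j \in ground N by rewrite groundN inE.
  pose e' i := enum_rank_in (inN (e i)) (e i).
  have e'K i : enum_val (e' i) = e i by rewrite enum_rankK_in ?inN.
  have e'_inj : injective e' by move=> i j /(congr1 enum_val); rewrite !e'K => /e_inj.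
  have <- : evalX (\det (mxsub f e' (liftability_matrix q N))) g = \det (mxsub f e L).
    rewrite /evalX -det_map_mx; congr (\det _); apply/matrixP => i j.
    by rewrite !mxE e'K.
  by apply: minors; exists [set: 'I_9], q, f, e'.
exists (kermx L^T); split.
  rewrite mxrank_ker mxrank_tr; move: rL; rewrite groundN cardsT card_ord => rL.
  by rewrite (@leq_trans (9 - 6)) // leq_sub2l.
move=> z /sub_kermxP zL.
pose phi a b c := z 0 a * det3 (col b g) (col c g) q + z 0 b * det3 (col c g) (col a g) q
      + z 0 c * det3 (col a g) (col b g) q.
have phi_sorted (a b c : 'I_9) : (a < b)%N -> (b < c)%N -> aligned a b c -> phi a b c = 0.
  move=> ab bc al; have u : uniq [:: a; b; c] by rewrite /= !inE -!val_eqE /=; lia.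
  have abcN : (a, b, c) \in circuit_triples N.
    have cP : circuit pascal [set a; b; c].
      by rewrite pascal_circuit3 ?card_set3 // mem_pascal_lines3.
    have [dC minC] := minsetP cP.
    rewrite inE /= ab bc /=; apply/minsetP; split=> [|B dB Babc].
      by rewrite /= -/N depN.
    by apply: minC => //; rewrite -depN.
  have /rowP/(_ (enum_rank_in abcN (a, b, c))) := zL.
  rewrite !mxE => zabc; rewrite -[RHS]zabc /phi.
  rewrite -(@lift_row_sum g q a b c [set: 'I_9] (fun x => z 0 x)) ?subsetT //.
  rewrite big_mkcond; apply: eq_bigr => j _.
  by rewrite !mxE enum_rankK_in // in_setT mulrC.
(* [phi] is invariant under rotation and changes sign under a transposition, so the increasing
   triples that index the rows suffice. *)
have phi_rot a b c : phi a b c = phi b c a by rewrite /phi -addrA addrC.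
have phi_swap a b c : phi b a c = - phi a b c by rewrite /phi; vec_ring.
have al_rot a b c : aligned a b c = aligned b c a.
  by apply: eq_has => l; rewrite andbC -andbA.
have al_swap a b c : aligned b a c = aligned a b c.
  by apply: eq_has => l; rewrite andbCA.
have phi_lt (a b c : 'I_9) : (a < b)%N -> (a < c)%N -> uniq [:: a; b; c] ->
    aligned a b c -> phi a b c = 0.
  move=> ab ac /= /andP[_ /andP[]]; rewrite inE => bc _ al.
  have [lt|lt|eq] := ltngtP b c; first exact: phi_sorted.
    by rewrite phi_rot phi_rot phi_swap phi_sorted ?oppr0 // al_swap -al_rot -al_rot.
  by rewrite -val_eqE /= eq eqxx in bc.
move=> a b c u al; rewrite -/(phi a b c).
have urot (d e f : 'I_9) : uniq [:: d; e; f] -> uniq [:: e; f; d].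
  by rewrite -(rot_uniq 1).
have [ab|ba|/val_inj ab] := ltngtP a b; last by move: u; rewrite ab /= inE eqxx.
  have [ac|ca|/val_inj ac] := ltngtP a c; last by move: u; rewrite ac /= !inE eqxx orbT.
    exact: phi_lt.
  rewrite phi_rot phi_rot; apply: phi_lt => //; first exact: ltn_trans ca ab.
    by do 2!apply: (urot).
  by rewrite al_rot.
have [bc|cb|/val_inj bc] := ltngtP b c; last by move: u; rewrite bc /= !inE eqxx andbF.
  by rewrite phi_rot; apply: phi_lt => //; [apply: (urot)|rewrite -al_rot].
rewrite phi_rot phi_rot; apply: phi_lt => //; first exact: ltn_trans cb ba.
  by do 2!apply: (urot).
by rewrite al_rot.
Qed.

End Lifting.

Section Main.
Variable K : numClosedFieldType.
Implicit Types (g h : 'M[K]_(3, 9)) (T : nat -> bool).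
Local Notation Pol := {mpoly K[3 * 9]}.

Lemma aligned_line (i j k : 'I_9) : uniq [:: i; j; k] -> aligned i j k ->
  exists l, [/\ line pascal l, l = [set i; j; k], i \in l, j \in l & k \in l].
Proof.
move=> u al; exists [set i; j; k].
by rewrite pascal_line mem_pascal_lines3 // al !inE !eqxx ?orbT.
Qed.

Lemma side_diagonal_neq i n : (i < 6)%N -> (n < 3)%N ->
  (side_idx i == diagonal_idx n) = false.
Proof.
rewrite -val_eqE /side_idx /diagonal_idx.
by case: n => [|[|[|//]]]; case: i => [|[|[|[|[|[|//]]]]]] _ _ /=; rewrite !inordK.
Qed.

Lemma diagonal_idx_eq i n : (i < 3)%N -> (n < 3)%N ->
  (diagonal_idx i == diagonal_idx n) = (i == n).
Proof.
rewrite -val_eqE /diagonal_idx.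
by case: n => [|[|[|//]]]; case: i => [|[|[|//]]] _ _ /=; rewrite !inordK.
Qed.

(** Starting from the bracket of the line {7,8,9}, stage [n] substitutes the column of diagonal [n]
    when [T n] holds. This affects neither the sides nor the other diagonals, so the earlier
    replacements are preserved. *)
Lemma GC_gens_partial_meet T n : (n <= 3)%N -> exists2 f : Pol, GC_gens pascal n f &
  forall g, evalX f g = let w i := partial_meet (fun i => (i < n)%N && T i) g i in
    det3 (w 0%N) (w 1%N) (w 2%N).
Proof.
elim: n => [|n IHn] n3.
  exists (bracket K (diagonal_idx 0) (diagonal_idx 1) (diagonal_idx 2)).
    have u : uniq [:: diagonal_idx 0; diagonal_idx 1; diagonal_idx 2].
      by rewrite /diagonal_idx /= !inE -!val_eqE /= !inordK.
    exists (diagonal_idx 0), (diagonal_idx 1), (diagonal_idx 2); split=> //; first exact: card_set3.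
    by rewrite pascal_circuit3 ?card_set3 // mem_pascal_lines3 // /diagonal_idx !inordK.
  by move=> g; rewrite meval_bracket.
have [f fn fE] := IHn (ltnW n3).
have [Tn|Tn] := boolP (T n); last first.
  exists f; first by left.
  move=> g; rewrite fE /=; suff wE i : partial_meet (fun i => (i < n)%N && T i) g i
      = partial_meet (fun i => (i < n.+1)%N && T i) g i by rewrite !wE.
  rewrite /partial_meet [in RHS]ltnS [in RHS]leq_eqVlt.
  by case: eqP => //= ->; rewrite (negPf Tn) andbF.
pose x := diagonal_idx n.
(* In this order of [p3] and [p4], [triple_cross] turns the substituted vector into [opposite_meet]
   with the right sign. *)
pose p1 := side_idx ((n + 5) %% 6); pose p2 := side_idx n.
pose p3 := side_idx ((n + 3) %% 6); pose p4 := side_idx (n + 2).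
have [u1 a1 u2 a2] : [/\ uniq [:: x; p1; p2], aligned x p1 p2,
    uniq [:: x; p3; p4] & aligned x p3 p4].
  rewrite /x /p1 /p2 /p3 /p4 /side_idx /diagonal_idx; clear -n3.
  by case: n n3 => [|[|[|//]]] _; rewrite /= !inE -!val_eqE /= !inordK.
have [l1 [l1P l1E x1 p11 p21]] := aligned_line u1 a1.
have [l2 [l2P l2E x2 p32 p42]] := aligned_line u2 a2.
exists (subst_col x (bracket K p1 p2 p3 *: col p4 (X K 9)
                     - bracket K p1 p2 p4 *: col p3 (X K 9)) f).
  right; exists f, x, l1, l2, p1, p2, p3, p4; split=> //; split; split=> //.
  rewrite l1E l2E; apply/negP => /eqP/setP/(_ p1).
  rewrite !inE eqxx orbT /= /x /p1 /p3 /p4 /side_idx /diagonal_idx; clear -n3.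
  by case: n n3 => [|[|[|//]]] _; rewrite -!val_eqE /= !inordK.
move=> g; rewrite meval_subst_col fE /=.
have vE : map_mx (meval (mxvec g ord0))
    (bracket K p1 p2 p3 *: col p4 (X K 9) - bracket K p1 p2 p4 *: col p3 (X K 9))
    = opposite_meet (hexagon_sides g) n.
  rewrite meval_meet.
  by rewrite /opposite_meet triple_cross !det3E.
rewrite vE; set v := opposite_meet _ _.
have sidesE i : (i < 6)%N -> hexagon_sides (set_col g x v) i = hexagon_sides g i.
  by move=> i6; rewrite /hexagon_sides col_set_col side_diagonal_neq.
have meetE i : (i < 3)%N -> opposite_meet (hexagon_sides (set_col g x v)) i
    = opposite_meet (hexagon_sides g) i.
  move=> i3; rewrite /opposite_meet !sidesE ?ltn_mod //.
    by case: i i3 => [|[|[|//]]].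
  exact: leq_trans i3 _.
have diagE i : (i < 3)%N -> hexagon_diagonals (set_col g x v) i
    = if i == n then v else hexagon_diagonals g i.
  by move=> i3; rewrite /hexagon_diagonals col_set_col diagonal_idx_eq.
suff wE i : (i < 3)%N -> partial_meet (fun i => (i < n)%N && T i) (set_col g x v) i
    = partial_meet (fun i => (i < n.+1)%N && T i) g i by rewrite !wE.
move=> i3; rewrite /partial_meet meetE // diagE // [in RHS]ltnS [in RHS]leq_eqVlt.
by case: eqP => [->|_] //=; rewrite ltnn Tn.
Qed.

Lemma GC_meet_det g T : vanishes_at g (GC_ideal K pascal) -> meet_det T g = 0.
Proof.
move=> GCg; have [f f3 fE] := GC_gens_partial_meet T (leqnn 3).
by have := GCg f (GC_gens_ideal f3); rewrite fE.
Qed.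

Lemma common_zero_inVM g : vanishes_at g (circuit_ideal K pascal) ->
  vanishes_at g (GC_ideal K pascal) -> vanishes_at g (lifting_ideal K pascal) ->
  inVM pascal g.
Proof.
move=> Cg Gg Lg.
have det0 (i j k : 'I_9) : uniq [:: i; j; k] -> aligned i j k ->
    det3 (col i g) (col j g) (col k g) = 0.
  move=> u al; rewrite -meval_bracket; apply/Cg/gen_sub_ideal.
  exists i, j, k; split=> //; first exact: card_set3.
  by rewrite pascal_circuit3 ?card_set3 // mem_pascal_lines3.
have liftK q := lifting_kernel q (fun f fm => Lg f (gen_sub_ideal fm)).
have [r r3 [A [B [gE A_full B_free]]]] : exists2 r, (r <= 3)%N &
    exists (A : 'M[K]_(3, r)) (B : 'M[K]_(r, 9)), [/\ g = A *m B, row_full A & row_free B].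
  exists (\rank g); first exact: rank_leq_row.
  exists (col_base g), (row_base g).
  by rewrite mulmx_base col_base_full row_base_free.
case: r r3 A B gE A_full B_free => [|[|[|[|//]]]] _ A B gE A_full B_free.
- have -> : g = 0 *m (0 : 'rV_9) by rewrite gE [A]thinmx0 !mul0mx.
  exact: rank1_inVM.
- by rewrite gE; exact: rank1_inVM.
- pose x : 'rV_9 := row ord0 B; pose y : 'rV_9 := row (lift ord0 ord0) B.
  have xyE (w : 'rV[K]_2) : w *m B = w 0 ord0 *: x + w 0 (lift ord0 ord0) *: y.
    by apply/rowP => j; rewrite !mxE !big_ord_recl big_ord0 addr0.
  apply: (@rank2_inVM _ g (col ord0 A) (col (lift ord0 ord0) A) x y) => //.
  + move=> j; apply/colP => i; rewrite gE !mxE !big_ord_recl big_ord0 addr0.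
    by rewrite mulrC [X in _ + X]mulrC.
  + have A_free : row_free A^T by rewrite /row_free mxrank_tr.
    have key (w : 'rV[K]_2) : w 0 ord0 *: col ord0 A
        + w 0 (lift ord0 ord0) *: col (lift ord0 ord0) A = 0 -> w = 0.
      move=> wA; apply: (row_free_inj A_free); rewrite mul0mx; apply/rowP => i.
      have /colP/(_ i) := wA; rewrite !mxE => wAi.
      by rewrite !big_ord_recl big_ord0 !mxE addr0.
    apply/negP => /eqP uv; have [u0|un] := eqVneq (col ord0 A) 0.
      have /rowP/(_ ord0)/eqP : delta_mx 0 ord0 = 0 :> 'rV[K]_2.
        by apply: key; rewrite u0 scaler0 add0r mxE /= scale0r.
      by rewrite !mxE oner_eq0.
    have [c vE] := parallelP un uv.
    have /rowP/(_ (lift ord0 ord0))/eqP :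
        c *: delta_mx 0 ord0 - delta_mx 0 (lift ord0 ord0) = 0 :> 'rV[K]_2.
      apply: key; rewrite vE !mxE /= mulr1 mulr0 subr0 sub0r scaleN1r.
      by rewrite subrr.
    by rewrite !mxE /= mulr0 sub0r oppr_eq0 oner_eq0.
  + suff -> : (col_mx x y : 'M_(2, 9)) = B by [].
    apply/matrixP => i j; rewrite mxE; case: splitP => k ik; rewrite ord1 mxE;
      by congr (B _ _); apply: val_inj; rewrite /= ik ord1.
- rewrite -(hexagonE g); apply: inVM_rank3.
  + move=> i i6; apply: det0; rewrite /side_idx /diagonal_idx;
    by case: i i6 => [|[|[|[|[|[|//]]]]]] _; rewrite /= ?inE -?val_eqE /= ?inordK.
  (* With [T] the set of vanishing diagonals, [meet_det] is the determinant required by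
     [inVM_rank3]. *)
  + exact: (GC_meet_det (fun i => hexagon_diagonals g i == 0) Gg).
  + move=> q; rewrite hexagonE => q0; apply/eqP; rewrite -trmx_eq0; apply/eqP.
    have g_free : row_free g by rewrite /row_free gE mxrankMfree.
    apply: (row_free_inj g_free); rewrite mul0mx; apply/rowP => j.
    have := q0 j; rewrite /dot !mxE !big_ord_recl big_ord0 !mxE addr0 => <-.
    by rewrite addrA.
Qed.

End Main.

Theorem theorem4p22 (R : realType) (p : {mpoly (complex R)[3 * 9]}) :
  matroid_ideal (complex R) pascal p <->
  radical
    (ideal_add
       (ideal_add (circuit_ideal (complex R) pascal)
                  (GC_ideal (complex R) pascal))
       (lifting_ideal (complex R) pascal)) p.
Proof.
have ideal_sum : is_ideal (ideal_add (ideal_add (circuit_ideal (complex R) pascal)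
    (GC_ideal (complex R) pascal)) (lifting_ideal (complex R) pascal)).
  apply: is_ideal_add; last exact: is_ideal_gen.
  by apply: is_ideal_add; [exact: is_ideal_gen|exact: is_ideal_GC].
split=> [pM|[m [a [b [[c [d [Ca Gd ->]]] Lb pE]]]]].
  apply: (nullstellensatz (@has_big_fibers_complex R) ideal_sum) => v vJ.
  pose g : 'M[complex R]_(3, 9) := vec_mx (\row_i v i).
  have vE f : evalX f g = f.@[v].
    by rewrite /evalX vec_mxK; apply: meval_eq => i; rewrite mxE.
  suff gV : inVM pascal g by rewrite -vE; exact: gV.
  apply: common_zero_inVM => f fJ; rewrite vE; apply: vJ.
  - by apply: ideal_add_left; [exact: is_ideal_gen|apply: ideal_add_left fJ; exact: is_ideal_GC].
  - by apply: ideal_add_left; [exact: is_ideal_gen|apply: ideal_add_right fJ; exact: is_ideal_gen].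
  - apply: ideal_add_right fJ; apply: is_ideal_add; [exact: is_ideal_gen|exact: is_ideal_GC].
apply/matroid_idealE => h Gh.
have Ch := vanishes_ideal_gen (circuit_brackets_Gamma Gh) Ca.
have Lh := vanishes_ideal_gen (lifting_minors_Gamma Gh) Lb.
have Dh : evalX d h = 0.
  have [s /(_ s (leqnn s)) ds] := Gd.
  apply: (vanishes_ideal_gen _ ds) => f fs.
  have := GC_gens_Gamma (const_mx 1) Gh fs.
  by rewrite diag_const_mx mulmx1.
have : evalX (p ^+ m) h = 0 by rewrite pE /evalX !mevalD -!/(evalX _ _) Ch Dh Lh !addr0.
by rewrite /evalX rmorphXn => /eqP; rewrite expf_eq0 => /andP[_ /eqP].
Qed.
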